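(* Let $Q$ be a probability measure on $\mathscr X$ with pdf $q$ with respect to the Lebesgue measure $\mu$, let $\omega_1,\ldots,\omega_n\in\mathscr X$, let $\widehat P=\frac1n\sum_{i=1}^n\delta_{\omega_i}$, let $s\ge 1$ and let $r_s\ge 0$ be the radius. Consider the problem $$\min_{P\in\mathscr P_s}\ \mathsf{KL}(P\|Q)\quad\text{such that}\quad \mathsf W_s(P,\widehat P)\le r_s .$$ Then the pdf $p^*$, with respect to $\mu$, of the least favorable distribution (the solution $P^*$ of this problem) satisfies $$p^*(x)\ \propto\ q(x)\,e^{-C_{\lambda^*,u^*}(x)},$$ where $\lambda^*\ge 0$ and $u^*\in\mathbb R^n$ are the optimizers of the problem $$\max_{\lambda\ge 0,\ u\in\mathbb R^n}\Big\{-\lambda r_s^s+\frac1n\sum_{i=1}^n u_i-\log\eta(\lambda,u)\Big\},$$ with $$C_{\lambda,u}(x):=\min_{1\le i\le n}\{\lambda c^s(x,\omega_i)-u_i\},\qquad \eta(\lambda,u):=\int q(x)e^{-C_{\lambda,u}(x)}\,d\mu(x).$$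
   Context: $\mathscr X$ is the observation space (the $X_k$ are random vectors with values in $\mathscr X$), $c(\cdot,\cdot):\mathscr X\times\mathscr X\to\mathbb R_+$ is a metric, and $c^s(x,y)=(c(x,y))^s$. $\delta_\omega$ is the Dirac measure at $\omega$. $\mathscr P_s$ is the set of all Borel probability measures $P$ on $\mathscr X$ with $\int_{\mathscr X}c^s(x,x_0)\,dP(x)<\infty$ for all $x_0\in\mathscr X$. For $P,\tilde P\in\mathscr P_s$ the Wasserstein distance of order $s$ is $$\mathsf W_s(P,\tilde P)=\Big\{\min_{\Gamma\in\Pi(P,\tilde P)}\int_{\mathscr X\times\mathscr X}c^s(\omega,\tilde\omega)\,d\Gamma(\omega,\tilde\omega)\Big\}^{1/s},$$ where $\Pi(P,\tilde P)$ is the set of joint probability measures on $\mathscr X\times\mathscr X$ with marginals $P$ and $\tilde P$. $\mathsf{KL}(P\|Q)=\int\log\big(\frac{dP}{dQ}(x)\big)dP(x)$, with $\frac{dP}{dQ}=\infty$ where the Radon–Nikodym derivative does not exist (so $\mathsf{KL}(P\|Q)=\infty$ if $P$ is not absolutely continuous with respect to $Q$). The symbol $\propto$ means equality up to a normalizing constant not depending on $x$. *)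

(* Defs.v *)
From HB Require Import structures.
From mathcomp Require Import all_boot all_order all_algebra.
From mathcomp Require Import all_classical all_reals all_analysis.

Set Implicit Arguments.
Unset Strict Implicit.
Unset Printing Implicit Defensive.

Import Order.TTheory GRing.Theory Num.Theory.
Import numFieldNormedType.Exports.

Local Open Scope classical_set_scope.
Local Open Scope ring_scope.

(* R^d with its Borel (= product) sigma-algebra. *)
Notation euclid R d := (d.-tuple (measurableTypeR R)).

Section lebesgue_euclid.
Context {R : realType}.
Local Open Scope ereal_scope.

Definition tcons d (x : measurableTypeR R * euclid R d) : euclid R d.+1 :=
  [tuple of x.1 :: x.2].

Lemma measurable_tcons d : measurable_fun [set: _] (@tcons d).
Proof.
exact: (@measurable_cons _ _ (measurableTypeR R * euclid R d)%type _
  fst d snd).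
Qed.

Definition tuncons d (t : euclid R d.+1) : measurableTypeR R * euclid R d :=
  (tnth t ord0, [tuple of behead t]).

Lemma tnth_tcons d x t (i : 'I_d) :
  tnth (tcons (x, t)) (lift ord0 i) = tnth t i.
Proof. by rewrite !(tnth_nth x). Qed.

Lemma tconsK d : cancel (@tcons d) (@tuncons d).
Proof. by move=> [x t]; congr pair; apply/val_inj. Qed.

Lemma tunconsK d : cancel (@tuncons d) (@tcons d).
Proof. by move=> t; rewrite [RHS](tuple_eta t). Qed.

Lemma measurable_tuncons d : measurable_fun [set: _] (@tuncons d).
Proof.
apply: measurable_fun_pair; first exact: measurable_tnth.
exact: measurable_behead.
Qed.

Section step.
Variables (d : nat) (mu : {sigma_finite_measure set (euclid R d) -> \bar R}).

Definition lebesgue_step : set (euclid R d.+1) -> \bar R :=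
  pushforward (lebesgue_measure \x mu) (@tcons d).

Let lebesgue_step0 : lebesgue_step set0 = 0.
Proof. by rewrite /lebesgue_step /pushforward preimage_set0 measure0. Qed.

Let lebesgue_step_ge0 A : 0 <= lebesgue_step A.
Proof. by rewrite /lebesgue_step /pushforward; exact: measure_ge0. Qed.

Let lebesgue_step_sigma_additive : semi_sigma_additive lebesgue_step.
Proof.
move=> F mF tF mUF; rewrite /lebesgue_step /pushforward preimage_bigcup.
apply: measure_semi_sigma_additive.
- by move=> i; rewrite -[X in measurable X]setTI; exact: measurable_tcons.
- apply/trivIsetP => /= i j _ _ ij; rewrite -preimage_setI.
  by move/trivIsetP : tF => /(_ _ _ _ _ ij) ->//; rewrite preimage_set0.
- rewrite -preimage_bigcup -[X in measurable X]setTI.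
  exact: measurable_tcons.
Qed.

HB.instance Definition _ := isMeasure.Build _ _ _ lebesgue_step
  lebesgue_step0 lebesgue_step_ge0 lebesgue_step_sigma_additive.

Lemma lebesgue_step_sigma_finite : sigma_finite setT lebesgue_step.
Proof.
have /sigma_finiteP[F [TF ndF Foo]] := sigma_finiteT (@lebesgue_measure R).
have /sigma_finiteP[G [TG ndG Goo]] := sigma_finiteT mu.
exists (fun i => @tuncons d @^-1` (F i `*` G i)).
  apply/esym/seteqP; split=> // t _.
  have [k _ Fk] : (\bigcup_i F i) (tuncons t).1 by rewrite -TF.
  have [l _ Gl] : (\bigcup_i G i) (tuncons t).2 by rewrite -TG.
  exists (maxn k l) => //; split.
    by move: Fk; exact/subsetPset/ndF/leq_maxl.
  by move: Gl; exact/subsetPset/ndG/leq_maxr.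
move=> i; have [mF Fi] := Foo i; have [mG Gi] := Goo i; split.
  rewrite -[X in measurable X]setTI.
  by apply: measurable_tuncons => //; exact: measurableX.
rewrite /lebesgue_step /pushforward -comp_preimage.
rewrite (_ : _ \o _ = id); last by apply/funext => x; exact: tconsK.
by rewrite preimage_id product_measure1E// lte_mul_pinfty// ge0_fin_numE.
Qed.

HB.instance Definition _ :=
  Measure_isSigmaFinite.Build _ _ _ lebesgue_step lebesgue_step_sigma_finite.

End step.

(* d-dimensional Lebesgue measure, as a d-fold product of lebesgue_measure. *)
Fixpoint lebesgue d : {sigma_finite_measure set (euclid R d) -> \bar R} :=
  match d with
  | 0 => \d_([tuple] : euclid R 0)
  | d'.+1 => lebesgue_step (lebesgue d')
  end.

Lemma lebesgue_box d (A : 'I_d -> set (measurableTypeR R)) :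
  (forall i, measurable (A i)) ->
  lebesgue d [set t | forall i, A i (tnth t i)] =
    \prod_(i < d) lebesgue_measure (A i).
Proof.
elim: d A => [|d ih] A mA /=.
  rewrite big_ord0 diracE mem_set//= => -[]//.
rewrite /lebesgue_step /pushforward.
rewrite (_ : _ @^-1` _ = A ord0 `*`
    [set t | forall i, A (lift ord0 i) (tnth t i)]); last first.
  apply/seteqP; split => -[x t] /=.
    move=> h; split => [|i]; first exact: (h ord0).
    by have := h (lift ord0 i); rewrite tnth_tcons.
  move=> [h0 h] i; case: (unliftP ord0 i) => [j ->|->//].
  by rewrite tnth_tcons.
rewrite product_measure1E//; first by rewrite big_ord_recl; congr mule; exact: ih.
rewrite (_ : [set t | _] = \bigcap_(i in [set: 'I_d])
    ((fun t : euclid R d => tnth t i) @^-1` A (lift ord0 i))); last first.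
  by apply/seteqP; split => t h i; [move=> _; exact: h|exact: (h i I)].
apply: fin_bigcap_measurable => // i _.
by rewrite -[X in measurable X]setTI; exact: measurable_tnth.
Qed.

End lebesgue_euclid.

(* The observation space is a Borel subset X of R^d; a Borel probability
   measure on X is encoded as a probability measure on R^d giving mass 1 to X. *)
Section robust.
Context {R : realType} {d : nat}.
Local Notation T := (euclid R d).
Implicit Types (X : set T) (c : T -> T -> R) (P Q : probability T R).

Definition metric_on X c : Prop :=
  [/\ forall x y, X x -> X y -> 0 <= c x y,
      forall x y, X x -> X y -> (c x y = 0 <-> x = y),
      forall x y, X x -> X y -> c x y = c y x
    & forall x y z, X x -> X y -> X z -> c x z <= c x y + c y z].

Definition concentrated_on X P : Prop := P X = 1%E.

Definition is_pdf X P (p : T -> R) : Prop :=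
  [/\ measurable_fun X p, forall x, X x -> 0 <= p x
    & forall A, measurable A ->
        P A = (\int[lebesgue d]_(x in A `&` X) (p x)%:E)%E].

Definition finite_moment X c (s : R) P : Prop :=
  concentrated_on X P /\
  forall x0, X x0 -> (\int[P]_(x in X) (c x x0 `^ s)%:E < +oo)%E.

Definition coupling P Q (G : probability (T * T)%type R) : Prop :=
  (forall A, measurable A -> G (A `*` setT) = P A) /\
  (forall A, measurable A -> G (setT `*` A) = Q A).

(* The minimum over couplings is taken as an infimum in \bar R, so that the
   distance is defined whether or not the minimum is attained or finite. *)
Definition wasserstein X c (s : R) P Q : \bar R :=
  (ereal_inf [set \int[G]_(z in X `*` X) (c z.1 z.2 `^ s)%:E
             | G in coupling P Q] `^ s^-1)%E.

Definition KL P Q : \bar R :=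
  if pselect (P `<< Q) then
    (\int[P]_x lne (Radon_Nikodym (charge_of_finite_measure P) Q x))%E
  else +oo%E.

Section empirical.
Variables (n : nat) (w : 'I_n.+1 -> T).

Definition empirical (A : set T) : \bar R :=
  ((n.+1%:R^-1)%:E * \sum_(i < n.+1) \d_(w i) A)%E.

Let empirical0 : empirical set0 = 0%E.
Proof. by rewrite /empirical big1 ?mule0// => i _; rewrite measure0. Qed.

Let empirical_ge0 A : (0 <= empirical A)%E.
Proof. by rewrite mule_ge0 ?lee_fin ?invr_ge0// sume_ge0. Qed.

Let empirical_sigma_additive : semi_sigma_additive empirical.
Proof.
move=> F mF tF mUF.
have n0 : 0 <= n.+1%:R^-1 :> R by rewrite invr_ge0.
pose m : {measure set T -> \bar R} := mscale (NngNum n0)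
  (msum (fun k => \d_(w (inord k)) : {measure set T -> \bar R}) n.+1).
have -> : empirical = m.
  apply/funext => A; rewrite /m /= /mscale /msum /empirical /=.
  by congr (_ * _)%E; apply: eq_bigr => i _; rewrite inord_val.
exact: measure_semi_sigma_additive.
Qed.

HB.instance Definition _ := isMeasure.Build _ _ _
  empirical empirical0 empirical_ge0 empirical_sigma_additive.

Let empiricalT : empirical setT = 1%E.
Proof.
rewrite /empirical (eq_bigr (fun=> 1%E)); last by move=> i _; rewrite diracT.
by rewrite sumEFin sumr_const card_ord -EFinM mulVf// pnatr_eq0.
Qed.

HB.instance Definition _ :=
  Measure_isProbability.Build _ _ _ empirical empiricalT.

End empirical.

Section problems.
Variables (X : set T) (c : T -> T -> R) (s r : R).
Variables (n : nat) (w : 'I_n.+1 -> T) (Q : probability T R) (q : T -> R).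

Definition feasible P : Prop :=
  finite_moment X c s P /\ (wasserstein X c s P (empirical w) <= r%:E)%E.

Definition least_favorable P : Prop :=
  feasible P /\ forall P', feasible P' -> (KL P Q <= KL P' Q)%E.

Implicit Types (lam : R) (u : 'I_n.+1 -> R).

Definition Ccost lam u (x : T) : R :=
  let f i := lam * c x (w i) `^ s - u i in
  \big[Num.min/f ord0]_(i < n.+1) f i.

Definition eta lam u : R :=
  \int[lebesgue d]_(x in X) (q x * expR (- Ccost lam u x)).

Definition dual lam u : R :=
  - lam * r `^ s + n.+1%:R^-1 * \sum_(i < n.+1) u i - ln (eta lam u).

Definition dual_optimizer lam u : Prop :=
  0 <= lam /\
  forall lam' u', 0 <= lam' -> dual lam' u' <= dual lam u.

End problems.

(* Proportionality on X, almost everywhere since densities are only defined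
   up to Lebesgue-null sets. *)
Definition proportional_on X (f g : T -> R) : Prop :=
  exists2 k : R, 0 < k & {ae lebesgue d, forall x, X x -> f x = k * g x}.

End robust.

(* Main.v *)
From HB Require Import structures.
Require Import Defs.
From mathcomp Require Import all_boot all_order all_algebra.
From mathcomp Require Import all_classical all_reals all_analysis.
From mathcomp Require Import measurable_realfun lra ring.
Set Implicit Arguments.
Unset Strict Implicit.
Unset Printing Implicit Defensive.
Import Order.TTheory GRing.Theory Num.Theory.
Import numFieldNormedType.Exports.
Local Open Scope classical_set_scope.
Local Open Scope ring_scope.

(** The theorem is a strong duality statement followed by the equality case of
    Gibbs' inequality.

    Let C be the function C_{lambda,u} at a dual optimum, let eta be the
    integral of exp(-C) against Q, and let G be the Gibbs measure
    dG = exp(-C) / eta dQ.  Any P within Wasserstein distance r of the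
    empirical measure satisfies
      int C dP <= lambda r^s - (1/n) sum_i u_i                [weak_duality],
    because C(x) <= lambda c^s(x, w_i) - u_i on the support of a coupling.
    Hence int log(dG/dQ) dP is at least the dual optimal value D.  If G is
    itself feasible and KL(G|Q) = D, a least favorable P has
      KL(P|Q) <= D <= int log(dG/dQ) dP,
    which is Gibbs' inequality in the wrong direction, so that P = G
    [gibbs_unique].  The density of G is the announced one.

    What has to be extracted from dual optimality is therefore that G is
    feasible and that int C dG = lambda r^s - (1/n) sum_i u_i.  No constraint
    qualification is at hand (the radius may sit exactly on the boundary of
    the radii for which the constraint can be met), so the optimality
    conditions are read off at the given optimizer.  All of them come from one
    inequality: since log x <= x - 1, for every other dual point (lambda',u')
      a' - a <= int (exp(C - C') - 1) dG           [optimal_increment],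
    where a and a' are the linear parts of the dual objective.

    - Moving along the ray (1+t)(lambda,u), with t of either sign, yields the
      value of int C dG [gibbs_mean].
    - Raising u by t on a set A of indices and letting t go to 0 yields
      |A|/n <= G{x : some i in A attains the minimum C(x)} [optimal_hall,
      argmin_hall].  This is Hall's condition for transporting G onto the
      uniform measure on the indices while moving x only to indices where the
      minimum is attained; the transport takes place between the finitely many
      possible sets of minimizing indices and the indices themselves, and a
      finite, fractional Hall theorem provides it [fractional_hall,
      argmin_kernel].  On this transport lambda c^s - u equals C, so its cost
      is r^s when lambda > 0.

    When lambda = 0 the last step says nothing about the cost.  There the dual
    inequality at (l, l v), as l decreases to 0, bounds the Kantorovich
    functional of the semidiscrete transport problem by r^s
    [zero_multiplier_laplace, integral_le_of_laplace]; this functional has a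
    maximizer, at which Hall's condition holds for the same reason as above,
    and the transport built from it has the value of the functional as its
    cost [kantorovich_maximizer, gibbs_plan]. *)

(** * A fractional Hall theorem *)

Lemma compact_box {R : realType} (I : eqType) (a b : I -> R) :
  compact [set f : prod_topology (fun _ : I => R) | forall i, a i <= f i <= b i].
Proof.
have := @tychonoff I (fun _ => R) (fun i => `[a i, b i]%classic)
  (fun i => @segment_compact R (a i) (b i)).
by congr compact; apply/seteqP; split=> f h i; have := h i; rewrite /= in_itv.
Qed.

Lemma continuous_sum_coord {R : realType} (I : eqType) (L : Type) (r : seq L)
    (F : L -> prod_topology (fun _ : I => R) -> R) :
  (forall l, continuous (F l)) ->
  continuous (fun f => \sum_(l <- r) F l f).
Proof.
move=> Fc; apply: continuous_big => // -[x y].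
by apply: cvgD; [exact: cvg_fst|exact: cvg_snd].
Qed.

(** Among the row-stochastic matrices supported on the relation E, which form a
    compact set, take one minimizing the sum of the squares of the excesses
    (column load minus demand).  A row of positive weight then never sends mass
    to a column while one of smaller excess is available, so the rows related to the set A of
    columns of minimal excess send all their mass into A.  Hall's condition
    for A makes this minimal excess nonnegative, and the excesses sum to 0.
    The rows are normalized to 1 rather than to g so that a row of weight 0
    still carries a transition probability. *)
Lemma fractional_hall {R : realType} (J K : finType) (g : J -> R) (a : K -> R)
    (E : J -> K -> bool) :
  (forall j, 0 <= g j) -> (forall j, exists k, E j k) ->
  \sum_k a k = \sum_j g j ->
  (forall A : {set K},
     \sum_(k in A) a k <= \sum_(j | [exists k in A, E j k]) g j) ->
  exists kap : J -> K -> R,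
    [/\ forall j k, 0 <= kap j k <= (E j k)%:R, forall j, \sum_k kap j k = 1 &
        forall k, \sum_j g j * kap j k = a k].
Proof.
move=> g0 En ag hall.
pose T := prod_topology (fun _ : J * K => R).
pose B : set T := [set f : T | forall p : J * K, 0 <= f p <= (E p.1 p.2)%:R].
pose S j : set T := (fun f : T => \sum_k f (j, k)) @^-1` [set 1].
have coordc p : continuous (fun f : T => f p) by exact: proj_continuous.
have Sc j : closed (S j).
  apply: preimage_closed; last exact: closed_eq.
  by move=> f _; apply: continuous_sum_coord => k; exact: coordc.
pose A := B `&` \bigcap_(j in setT) S j.
have cA : compact A.
  apply: compact_closedI; last by apply: closed_bigI => j _; exact: Sc.
  exact: (@compact_box R _ (fun=> 0) (fun p : J * K => (E p.1 p.2)%:R)).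
pose y (f : T) k : R := \sum_j g j * f (j, k) - a k.
pose Phi (f : T) : R := \sum_k y f k ^+ 2.
have Pc : continuous Phi.
  have lc k : continuous (fun h : T => \sum_j g j * h (j, k)).
    apply: continuous_sum_coord => j f.
    exact: (cvgM (cvg_cst (g j)) (@coordc (j, k) f)).
  have yc k : continuous (fun h : T => y h k).
    by move=> f; exact: (cvgB (@lc k f) (cvg_cst (a k))).
  apply: continuous_sum_coord => k f.
  exact: (cvgM (@yc k f) (@yc k f)).
have A0 : A !=set0.
  exists (fun p : J * K => (p.2 == xchoose (En p.1))%:R); split.
    move=> [j k] /=; rewrite ler0n/= ler_nat.
    by have [->|] := eqVneq k; rewrite ?(xchooseP (En j)).
  move=> j _; rewrite /S /= (bigD1 (xchoose (En j)))//= eqxx big1 ?addr0//.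
  by move=> k /negbTE ->.
have [f /[!inE] -[fB fS] fmin] := compact_EVT_min A0 cA (continuous_subspaceT Pc).
have rowS j : \sum_k f (j, k) = 1 by have := fS j Logic.I.
(* By minimality, row j cannot profit from moving mass from k to k'. *)
have move_mass j k k' : 0 < f (j, k) -> 0 < g j -> E j k' -> y f k <= y f k'.
  move=> fjk gj Ejk'; rewrite leNgt; apply/negP => yy.
  have kk' : k != k' by apply: contraTneq yy => ->; rewrite ltxx.
  (* Half of the step that would equalize the two excesses. *)
  pose eps := Num.min (f (j, k)) ((y f k - y f k') / (2 * g j)).
  have e0 : 0 < eps by rewrite lt_min fjk divr_gt0 ?subr_gt0// mulr_gt0.
  pose f' : T := fun p => f p + (if p.1 == j then
     (if p.2 == k' then eps else if p.2 == k then - eps else 0) else 0).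
  have row' i : \sum_l f' (i, l) = \sum_l f (i, l).
    rewrite /f' big_split /=; case: (i == j); last by rewrite [X in _ + X]big1 ?addr0.
    rewrite [X in _ + X](bigD1 k')//= eqxx [X in _ + (_ + X)](bigD1 k)//=.
    rewrite (negbTE kk') eqxx [X in _ + (_ + (_ + X))]big1.
      by rewrite addr0 subrr addr0.
    by move=> l /andP[/negbTE -> /negbTE ->].
  have f'A : A f'.
    split=> [[i l]|i _]; last by rewrite /S /= row' rowS.
    rewrite /f' /=; have /andP[f0 f1] := fB (i, l).
    have [->|_] := eqVneq i j; last by rewrite addr0 f0.
    have [->|lk'] := eqVneq l k'.
      rewrite Ejk' addr_ge0 ?(ltW e0)//=; last by have /andP[] := fB (j, k').
      have /andP[p0 _] := fB (j, k').
      have := rowS j; rewrite (bigD1 k')//= (bigD1 k)//=.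
      set r := (X in _ + (_ + X) = _); move=> r1.
      have : 0 <= r by apply: sumr_ge0 => q _; have /andP[] := fB (j, q).
      have : eps <= f (j, k) by rewrite ge_min lexx.
      rewrite /=; lra.
    have [->|lk] := eqVneq l k; last by rewrite addr0; exact: fB.
    have /andP[_ /= p1] := fB (j, k).
    rewrite subr_ge0 ge_min lexx/=; move: e0 p1; clear; lra.
  have yl l : y f' l = y f l + (if l == k' then g j * eps else if l == k then - (g j * eps) else 0).
    rewrite /y /f'.
    under eq_bigr do rewrite mulrDr.
    rewrite big_split/= [X in _ + X - _](bigD1 j)//= eqxx.
    rewrite [X in _ + (_ + X) - _]big1 ?addr0.
    2: by move=> i /negbTE ->; rewrite mulr0.
    by do 2?[case: ifP => _]; lra.
  have := fmin f'; rewrite !inE => /(_ f'A).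
  have PhiE h : Phi h = y h k ^+ 2 + (y h k' ^+ 2 +
      \sum_(l | (l != k) && (l != k')) y h l ^+ 2).
    by rewrite /Phi (bigD1 k)//= (bigD1 k')//= eq_sym.
  rewrite leNgt => /negP; apply; rewrite !PhiE.
  rewrite !yl eqxx (negbTE kk') eqxx.
  rewrite [X in _ + (_ + X) < _](@eq_bigr _ _ _ _ _ _ _ (fun l => y f l ^+ 2)); last first.
    by move=> l /andP[lk lk']; rewrite yl (negbTE lk') (negbTE lk) addr0.
  rewrite !addrA ltrD2r.
  set del := g j * eps.
  have d0 : 0 < del by rewrite mulr_gt0.
  have d1 : 2 * del <= y f k - y f k'.
    rewrite /del mulrA -ler_pdivlMl ?mulr_gt0// mulrC /eps ge_min lexx orbT//.
  have : 0 <= del * (y f k - y f k' - 2 * del) by rewrite mulr_ge0 ?(ltW d0)// subr_ge0.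
  have : 0 < del * del by rewrite mulr_gt0.
  rewrite !expr2; nra.
exists (fun j k => f (j, k)); split=> [j k|//|]; first exact: (fB (j, k)).
(* Nonnegative excesses with zero sum vanish. *)
suff ge k : 0 <= y f k.
  have s0 : \sum_k y f k = 0.
    rewrite /y sumrB exchange_big/= ag.
    under eq_bigr do rewrite -mulr_sumr rowS mulr1.
    by rewrite subrr.
  move=> k; apply/eqP; rewrite -subr_eq0; apply/eqP.
  by have /(_ k) := psumr_eq0P (fun k _ => ge k) s0; exact.
have [/= m _ ym] := @arg_minP _ R K k predT (y f) isT.
apply: le_trans (ym k isT); rewrite leNgt; apply/negP => ym0.
(* Columns of minimal excess, to which Hall's condition is applied. *)
pose M : {set K} := [set l | y f l == y f m]%SET.
have := hall M; apply/negP; rewrite -ltNge.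
have M_out j l : [exists q in M, E j q] -> l \notin M -> g j * f (j, l) = 0.
  case/existsP => q /andP[]; rewrite !inE => /eqP yq Ejq lM.
  have /andP[f0 _] := fB (j, l).
  have [->|gj0] := eqVneq (g j) 0; first by rewrite mul0r.
  have [->|fjl0] := eqVneq (f (j, l)) 0; first by rewrite mulr0.
  have := @move_mass j l q; rewrite !lt_def fjl0 gj0 g0 f0 => /(_ isT isT Ejq).
  by rewrite yq => le; case/negP: lM; rewrite eq_le le ym.
have -> : \sum_(j | [exists q in M, E j q]) g j = \sum_(l in M) \sum_j g j * f (j, l).
  rewrite exchange_big/= [RHS](bigID (fun j => [exists q in M, E j q]))/=.
  rewrite [X in _ = _ + X]big1 ?addr0.
    apply: eq_bigr => j jM; rewrite -[LHS]mulr1 -(rowS j) mulr_sumr.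
    rewrite (bigID (mem M))/= [X in _ + X]big1 ?addr0// => l lM.
    exact: M_out.
  move=> j jM; apply: big1 => l lM.
  have /andP[f0] := fB (j, l); rewrite /= => f1.
  suff -> : f (j, l) = 0 by rewrite mulr0.
  apply/eqP; rewrite eq_le f0 andbT (le_trans f1)//.
  suff /negbTE -> : ~~ E j l by [].
  by apply: contra jM => Ejl; apply/existsP; exists l; rewrite lM.
rewrite -subr_lt0 -sumrB (bigD1 m) ?inE//=.
apply: ltr_wnDr => //; apply: sumr_le0 => l /andP[]; rewrite inE => /eqP yl _.
by have := ltW ym0; rewrite -yl.
Qed.

(** * Measures given by a density *)

Section density_measure.
Context d (T : measurableType d) (R : realType).
Variables (mu : {measure set T -> \bar R}) (f : T -> R).
Hypotheses (fi : mu.-integrable setT (EFin \o f)) (f0 : forall x, 0 <= f x).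

Definition density_measure of mu.-integrable setT (EFin \o f)
  & (forall x, 0 <= f x) := fun A : set T => (\int[mu]_(x in A) (f x)%:E)%E.

Local Notation nu := (density_measure fi f0).

Let nu0 : nu set0 = 0%E. Proof. exact: integral_set0. Qed.

Let nu_ge0 A : (0 <= nu A)%E.
Proof. by apply: integral_ge0 => x _; rewrite lee_fin. Qed.

Let nu_sigma_additive : semi_sigma_additive nu.
Proof.
apply: semi_sigma_additive_nng_induced; first exact: measurable_int fi.
by move=> x; rewrite lee_fin.
Qed.

HB.instance Definition _ := isMeasure.Build _ _ _ nu nu0 nu_ge0 nu_sigma_additive.

Let nu_fin : fin_num_fun nu.
Proof.
by move=> A mA; apply: integrable_fin_num => //; exact: integrableS fi.
Qed.

HB.instance Definition _ := Measure_isFinite.Build _ _ _ nu nu_fin.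

End density_measure.

(** Normalizing a measure of mass 1 changes nothing but provides the
    structure of a probability. *)
Lemma probability_of_measure d (T : measurableType d) (R : realType)
    (m : {measure set T -> \bar R}) :
  m setT = 1%E -> exists P : probability T R, forall A, P A = m A.
Proof.
move=> m1; exists (mnormalize m point) => A.
rewrite /= /mnormalize; case: ifPn => [/orP[]/eqP e|_].
- by have /eqP := etrans (esym m1) e; rewrite onee_eq0.
- by have := etrans (esym m1) e.
- by rewrite (_ : fine _ = 1) ?invr1 ?mule1//; exact: (congr1 fine m1).
Qed.

Section density.
Context d (T : measurableType d) (R : realType).

Definition has_density (mu nu : set T -> \bar R) (f : T -> R) :=
  [/\ measurable_fun setT f, forall x, 0 <= f x &
      forall A, measurable A -> nu A = (\int[mu]_(x in A) (f x)%:E)%E].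

Lemma probability_with_density (mu : {measure set T -> \bar R}) (f : T -> R) :
  measurable_fun setT f -> (forall x, 0 <= f x) ->
  (\int[mu]_x (f x)%:E = 1)%E ->
  exists P : probability T R, has_density mu P f.
Proof.
move=> mf f0 f1.
have fi : mu.-integrable setT (EFin \o f).
  apply/integrableP; split; first exact/measurable_EFinP.
  rewrite (_ : (\int[mu]_x _)%E = 1%E) ?ltry// -[RHS]f1.
  by apply: eq_integral => x _ /=; rewrite ger0_norm.
have [P PE] := @probability_of_measure _ _ _ (density_measure fi f0) f1.
by exists P; split=> // A mA; rewrite PE.
Qed.

Variables (mu : {sigma_finite_measure set T -> \bar R}).
Variables (nu : {finite_measure set T -> \bar R}) (f : T -> R).
Hypothesis nuf : has_density mu nu f.

Lemma has_density_dominates : nu `<< mu.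
Proof.
have [mf f0 fE] := nuf.
apply/null_content_dominatesP => A mA A0; rewrite fE//.
by apply: null_set_integral => //; exact/measurable_funTS/measurable_EFinP.
Qed.

(** Identifying f with the Radon-Nikodym derivative turns the change of
    variables formula for the latter into one for any explicit density. *)
Lemma density_ae_Radon_Nikodym :
  ae_eq mu setT (Radon_Nikodym_SigmaFinite.f nu mu) (EFin \o f).
Proof.
have [mf f0 fE] := nuf; have numu := has_density_dominates.
apply: integral_ae_eq => //; first exact: Radon_Nikodym_SigmaFinite.f_integrable.
  exact/measurable_EFinP.
by move=> A _ mA; rewrite -Radon_Nikodym_SigmaFinite.f_integral// fE.
Qed.

Lemma ge0_integral_density (g : T -> R) : measurable_fun setT g ->
  (forall x, 0 <= g x) ->
  (\int[nu]_x (g x)%:E = \int[mu]_x (g x * f x)%:E)%E.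
Proof.
move=> mg g0; have [mf f0 fE] := nuf; have numu := has_density_dominates.
have g0' x : (0 <= (g x)%:E)%E by rewrite lee_fin.
have mg' : measurable_fun setT (EFin \o g) by exact/measurable_EFinP.
rewrite -(Radon_Nikodym_SigmaFinite.change_of_variables numu g0' measurableT mg').
apply: ae_eq_integral => //.
- apply: emeasurable_funM; first exact/measurable_EFinP.
  exact: measurable_int (Radon_Nikodym_SigmaFinite.f_integrable numu).
- by apply/measurable_EFinP; exact: measurable_funM.
- apply: filterS density_ae_Radon_Nikodym => x /= /(_ Logic.I) -> _.
  by rewrite EFinM.
Qed.

Lemma integrable_density (g : T -> R) : measurable_fun setT g ->
  nu.-integrable setT (EFin \o g) <->
  mu.-integrable setT (EFin \o (fun x => g x * f x)).
Proof.
move=> mg; have [mf f0 fE] := nuf.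
have absE : (\int[nu]_x `|(EFin \o g) x| =
             \int[mu]_x `|(EFin \o (fun x => g x * f x)%R) x|)%E.
  transitivity (\int[nu]_x (`|g x|%R)%:E)%E; first by [].
  rewrite (@ge0_integral_density (fun x => `|g x|))//; last exact: measurableT_comp.
  by apply: eq_integral => x _ /=; rewrite normrM (ger0_norm (f0 x)).
split=> /integrableP[_ fin]; apply/integrableP; split.
- by apply/measurable_EFinP; exact: measurable_funM.
- by rewrite -absE.
- exact/measurable_EFinP.
- by rewrite absE.
Qed.

Lemma Rintegral_density (g : T -> R) : measurable_fun setT g ->
  nu.-integrable setT (EFin \o g) ->
  \int[nu]_x g x = \int[mu]_x (g x * f x).
Proof.
move=> mg ig; have [mf f0 fE] := nuf.
have igf := (integrable_density mg).1 ig.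
have gE x : g x = Num.max (g x) 0 - Num.max (- g x) 0.
  by rewrite /Num.max; do 2 case: ifP; lra.
have mp : measurable_fun setT (fun x => Num.max (g x) 0).
  exact: measurable_maxr.
have mn : measurable_fun setT (fun x => Num.max (- g x) 0).
  by apply: measurable_maxr => //; exact: measurable_funN.
have ip : nu.-integrable setT (EFin \o (fun x => Num.max (g x) 0)).
  apply: le_integrable ig => //; first exact/measurable_EFinP.
  by move=> x _ /=; rewrite lee_fin /Num.max; case: ifP; rewrite ?normr0// ltxx.
have inn : nu.-integrable setT (EFin \o (fun x => Num.max (- g x) 0)).
  apply: le_integrable ig => //; first exact/measurable_EFinP.
  by move=> x _ /=; rewrite lee_fin /Num.max; case: ifP; rewrite ?normr0 ?normrN.
under eq_Rintegral do rewrite gE.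
rewrite RintegralB//.
under [RHS]eq_Rintegral do rewrite gE mulrBl.
rewrite RintegralB//; [|exact/(integrable_density mp)|exact/(integrable_density mn)].
by rewrite /Rintegral !ge0_integral_density// => x; rewrite le_max lexx orbT.
Qed.

End density.

(** * Exponential bounds and pointwise minima *)

Section expR_bounds.
Context {R : realType}.
Implicit Types x : R.

Lemma expR_sub1_le_mul x : expR x - 1 <= x * expR x.
Proof.
have : (1 - x) * expR x <= expR (- x) * expR x.
  by rewrite ler_wpM2r ?expR_ge0// expR_ge1Dx.
by rewrite -expRD addNr expR0; lra.
Qed.

(** Second-order upper bound valid for both signs of x: it differentiates
    integrals of exponentials at 0 without dominated convergence. *)
Lemma expR_sub1_le_quad x : expR x - 1 <= x + x ^+ 2 * expR `|x|.
Proof.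
have h := expR_sub1_le_mul x; have h1 := expR_ge1Dx x.
have e1 : 1 <= expR `|x| by rewrite -expR0 ler_expR.
have [x0|x0] := leP 0 x.
  have : 0 <= x * (x * expR x - (expR x - 1)) by rewrite mulr_ge0 ?subr_ge0.
  by rewrite ger0_norm// expr2; lra.
have : 0 <= - x * (expR x - 1 - x) by rewrite mulr_ge0 ?oppr_ge0 ?(ltW x0)//; lra.
have : 0 <= x ^+ 2 * (expR `|x| - 1) by rewrite mulr_ge0 ?sqr_ge0 ?subr_ge0.
by rewrite expr2; lra.
Qed.

End expR_bounds.

Lemma sum_natr_mem {R : realType} {n : nat} (A : {set 'I_n}) :
  \sum_i (i \in A)%:R = #|A|%:R :> R.
Proof.
have -> : #|A| = (\sum_(i < n) (i \in A))%N; last by rewrite natr_sum.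
by rewrite -sum1_card big_mkcond; apply: eq_bigr => i _; case: (i \in A).
Qed.

Section pointwise_min.
Context {R : realType} {T : Type} {n : nat}.
Implicit Types phi psi : 'I_n.+1 -> T -> R.

(** The initial value of the iterated minimum is one of the values, so that it
    does not interfere. *)
Definition pwmin phi (x : T) : R :=
  \big[Num.min/phi ord0 x]_(i < n.+1) phi i x.

Lemma pwmin_le phi i x : pwmin phi x <= phi i x.
Proof. exact: bigmin_le. Qed.

Lemma le_pwmin phi x (a : R) : (forall i, a <= phi i x) -> a <= pwmin phi x.
Proof. by move=> h; apply/bigmin_geP; split. Qed.

Lemma pwmin_attained phi x : exists i, pwmin phi x = phi i x.
Proof.
have [/= i _ im] := @arg_minP _ R _ ord0 predT (phi^~ x) isT.
exists i; apply/eqP; rewrite eq_le pwmin_le le_pwmin// => j; exact: im.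
Qed.

Lemma eq_pwmin phi psi x : (forall i, phi i x = psi i x) ->
  pwmin phi x = pwmin psi x.
Proof. by move=> h; rewrite /pwmin h; apply: eq_bigr => i _. Qed.

End pointwise_min.

Lemma measurable_pwmin {R : realType} {d} {T : measurableType d} {n : nat}
    (phi : 'I_n.+1 -> T -> R) :
  (forall i, measurable_fun setT (phi i)) -> measurable_fun setT (pwmin phi).
Proof.
move=> mphi; rewrite /pwmin; elim: (index_enum _) => [|i r ih].
  under eq_fun do rewrite big_nil; exact: mphi.
by under eq_fun do rewrite big_cons; exact: measurable_minr.
Qed.

Definition reduced_cost {R : realType} {T : Type} {n : nat}
    (f : 'I_n.+1 -> T -> R) (lam : R) (u : 'I_n.+1 -> R) i x := lam * f i x - u i.

Lemma measurable_reduced_cost {R : realType} {d} {T : measurableType d} {n : nat}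
    (f : 'I_n.+1 -> T -> R) (lam : R) (u : 'I_n.+1 -> R) i :
  measurable_fun setT (f i) -> measurable_fun setT (reduced_cost f lam u i).
Proof. by move=> mf; apply: measurable_funB => //; exact: measurable_funM. Qed.

Lemma bounded_integrable {R : realType} {d} {T : measurableType d}
    (P : probability T R) (f : T -> R) (K : R) :
  measurable_fun setT f -> (forall x, `|f x| <= K) ->
  P.-integrable setT (EFin \o f).
Proof.
move=> mf fK.
apply: (@le_integrable _ _ _ P _ measurableT _ (cst K%:E)).
- exact/measurable_EFinP.
- by move=> x _ /=; rewrite lee_fin (le_trans (fK x))// ler_norm.
- exact: finite_measure_integrable_cst.
Qed.

Lemma Rintegral_cst_probability {R : realType} {d} {T : measurableType d}
    (P : probability T R) (k : R) : \int[P]_x k = k.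
Proof.
rewrite Rintegral_cst// (_ : fine _ = 1) ?mulr1//.
exact: (congr1 fine (probability_setT P)).
Qed.

Lemma Rintegral_sum {R : realType} {d} {T : measurableType d}
    (mu : {measure set T -> \bar R}) (L : Type) (r : seq L) (F : L -> T -> R) :
  (forall l, mu.-integrable setT (EFin \o F l)) ->
  \int[mu]_x (\sum_(l <- r) F l x) = \sum_(l <- r) \int[mu]_x F l x.
Proof.
move=> Fi; elim: r => [|l r ih].
  rewrite big_nil (@eq_Rintegral _ _ _ _ _ (cst 0)).
    by rewrite /Rintegral /= integral0.
  by move=> x _; rewrite big_nil.
rewrite big_cons -ih -RintegralD//.
  by apply: eq_Rintegral => x _; rewrite big_cons.
have := @integrable_sum _ _ _ mu setT measurableT L r predT (fun l => EFin \o F l).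
move=> /(_ (fun l _ => Fi l)); apply: eq_integrable => // x _ /=.
by rewrite sumEFin.
Qed.

Lemma measurable_coincidence {R : realType} {d} {T : measurableType d}
    (f g : T -> R) :
  measurable_fun setT f -> measurable_fun setT g -> measurable [set x | f x = g x].
Proof.
move=> mf mg.
have := @measurable_fun_eqr _ _ R setT f g mf mg measurableT [set true] Logic.I.
rewrite setTI; congr measurable.
by apply/seteqP; split=> x /=; [move/eqP|move->; rewrite eqxx].
Qed.

(** * Transition kernels carried by the minimizing indices *)

Section argmin_kernel.
Context {R : realType} {d} {T : measurableType d} {n : nat}.
Variables (G : probability T R) (phi : 'I_n.+1 -> T -> R).
Hypothesis mphi : forall i, measurable_fun setT (phi i).

Let C := pwmin phi.

Let mC : measurable_fun setT C. Proof. exact: measurable_pwmin. Qed.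

Let near_argmin (A : {set 'I_n.+1}) (t : R) :=
  [set x | exists2 i, i \in A & phi i x <= C x + t].

Let measurable_near_argmin A t : measurable (near_argmin A t).
Proof.
rewrite (_ : near_argmin A t =
    \bigcup_(i in [set i | i \in A]) [set x | phi i x <= C x + t]).
  apply: fin_bigcup_measurable => // i _.
  rewrite -[X in measurable X]setTI.
  apply: measurable_fun_ler => //.
  by apply: measurable_funD => //.
by apply/seteqP; split=> x [i iA ix]; exists i.
Qed.

(** Raising the potential by t on A changes the minimum C by at most t, and
    only at points where an index of A is within t of being minimal.  The
    hypothesis thus bounds #|A| / n.+1, up to a factor tending to 1, by the
    probability of these points, which decrease to the points where an index
    of A is minimal as t tends to 0. *)
Lemma argmin_hall :
  (forall (A : {set 'I_n.+1}) (t : R), 0 < t ->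
     t * (#|A|%:R / n.+1%:R) <=
     \int[G]_x (expR (C x - pwmin (fun i x => phi i x - t * (i \in A)%:R) x) - 1)) ->
  forall A : {set 'I_n.+1},
    (#|A|%:R / n.+1%:R <= fine (G [set x | exists2 i, i \in A & phi i x = C x])).
Proof.
move=> dual A.
have bound t : 0 < t -> t < 1 ->
    #|A|%:R / n.+1%:R <= fine (G (near_argmin A t)) + t.
  move=> t0 t1.
  have fG : G (near_argmin A t) \is a fin_num by exact: fin_num_measure.
  pose D x := C x - pwmin (fun i x => phi i x - t * (i \in A)%:R) x.
  have D0 x : 0 <= D x.
    rewrite subr_ge0 /C; have [i ->] := pwmin_attained phi x.
    apply: le_trans (pwmin_le _ i x) _.
    by rewrite gerBl mulr_ge0 ?ler0n ?(ltW t0).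
  have Dt x : D x <= t.
    rewrite lerBlDr -lerBlDl le_pwmin// => i.
    have := pwmin_le phi i x; rewrite -/(C x) => ?.
    have : t * (i \in A)%:R <= t * 1 by rewrite ler_pM2l// lern1 leq_b1.
    by lra.
  have Dout x : ~ near_argmin A t x -> D x = 0.
    move=> xB; apply/eqP; rewrite eq_le D0 andbT subr_le0 le_pwmin// => i.
    have [iA|iA] := boolP (i \in A); last by rewrite mulr0 subr0 pwmin_le.
    rewrite mulr1 leNgt; apply/negP => h; apply: xB; exists i => //.
    by rewrite -lerBlDr ltW.
  have mD : measurable_fun setT D.
    apply: measurable_funB => //; apply: measurable_pwmin => i.
    exact: measurable_funB.
  have := dual A t t0; rewrite -/D.
  have le1 : \int[G]_x (expR (D x) - 1) <=
      \int[G]_x (t * expR t * \1_(near_argmin A t) x).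
    apply: le_Rintegral => //.
    - apply: (@bounded_integrable _ _ _ _ _ (expR t)).
        by apply: measurable_funB => //; exact: measurableT_comp.
      move=> x; have e1 : 1 <= expR (D x) by rewrite -expR0 ler_expR.
      rewrite ger0_norm ?subr_ge0// lerBlDr ler_wpDr//.
      by rewrite ler_expR.
    - apply: (@bounded_integrable _ _ _ _ _ (t * expR t)) => [|x].
        by apply: measurable_funM => //; exact: measurable_indic.
      rewrite normrM ger0_norm ?mulr_ge0 ?expR_ge0 ?(ltW t0)//.
      rewrite ler_piMr ?mulr_ge0 ?expR_ge0 ?(ltW t0)//.
      by rewrite indicE; case: (_ \in _); rewrite ?normr1 ?normr0.
    - move=> x _; apply: le_trans (expR_sub1_le_mul _) _.
      rewrite indicE; have [xB|xB] := boolP (x \in near_argmin A t).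
        by rewrite mulr1 ler_pM ?expR_ge0// ler_expR.
      by rewrite Dout ?mul0r ?mulr0//; move/negP: xB; apply: contra_not; rewrite inE.
  move=> h; have {le1 h} := le_trans h le1.
  rewrite RintegralZl//; last first.
    by apply: integrable_indic.
  rewrite /Rintegral integral_indic// setIT -mulrA ler_pM2l// => h.
  have a1 : #|A|%:R / n.+1%:R <= 1 :> R.
    rewrite ler_pdivrMr ?ltr0n// mul1r ler_nat.
    by rewrite (leq_trans (max_card _))// card_ord.
  have a0 : 0 <= #|A|%:R / n.+1%:R :> R by rewrite divr_ge0.
  (* exp t <= 1 / (1 - t), so the factor exp t costs at most t in the end. *)
  have e1 : (1 - t) * expR t <= 1.
    have : (1 - t) * expR t <= expR (- t) * expR t.
      by rewrite ler_wpM2r ?expR_ge0// expR_ge1Dx.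
    by rewrite -expRD addNr expR0.
  have g0 : 0 <= fine (G (near_argmin A t)) by rewrite fine_ge0.
  have h1 : (1 - t) * (#|A|%:R / n.+1%:R) <= (1 - t) * (expR t * fine (G (near_argmin A t))).
    by rewrite ler_pM2l ?subr_gt0.
  have h2 : (1 - t) * expR t * fine (G (near_argmin A t)) <= 1 * fine (G (near_argmin A t)).
    by rewrite ler_wpM2r.
  have h3 : t * (#|A|%:R / n.+1%:R) <= t * 1 by rewrite ler_pM2l.
  rewrite -mulrA in h2; have := le_trans h1 h2.
  move: h3; move: (_ / _) (fine _) => a g; lra.
(* The shift by 2 keeps the radii below 1. *)
pose s k : R := k.+2%:R^-1.
have s0 k : 0 < s k by rewrite invr_gt0.
have s1 k : s k < 1 by rewrite invf_lt1// ltr1n.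
pose B k := near_argmin A (s k).
have Bcap : \bigcap_k B k = [set x | exists2 i, i \in A & phi i x = C x].
  apply/seteqP; split=> x; last first.
    by move=> [i iA e] k _; exists i => //; rewrite e lerDl ltW.
  move=> h; apply: contrapT => no.
  have gap i : i \in A -> C x < phi i x.
    move=> iA; rewrite lt_neqAle pwmin_le andbT; apply/eqP => e.
    by apply: no; exists i.
  have [e e0 egap] : exists2 e : R, 0 < e & forall i, i \in A -> C x + e <= phi i x.
    exists (\big[Num.min/1]_(i in A) (phi i x - C x)).
      by apply/bigmin_gtP; split=> // i iA; rewrite subr_gt0 gap.
    by move=> i iA; rewrite -lerBrDl; exact: bigmin_le_cond.
  have [k ke] : exists k, s k < e.
    exists (Num.truncn e^-1).
    rewrite invf_plt ?posrE//.
    apply: lt_trans (truncnS_gt _) _.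
    by rewrite ltr_nat.
  have [i iA] := h k Logic.I; have := egap i iA; lra.
have Bni : nonincreasing_seq B.
  move=> k l kl; apply/subsetPset => x [i iA ix]; exists i => //.
  apply: le_trans ix _; rewrite lerD2l lef_pV2 ?posrE//.
  by rewrite ler_nat !ltnS.
have mB k : measurable (B k) by exact: measurable_near_argmin.
have mBc : measurable (\bigcap_k B k) by exact: bigcapT_measurable.
have cB : fine (G (B k)) + s k @[k --> \oo] --> fine (G (\bigcap_k B k)) + 0.
  apply: cvgD; last first.
    by rewrite (cvg_shiftS (@harmonic R)); exact: cvg_harmonic.
  apply: fine_cvg; rewrite fineK ?fin_num_measure//.
  apply: nonincreasing_cvg_mu => //.
  by rewrite -ge0_fin_numE// fin_num_measure.
rewrite -Bcap -[leRHS]addr0 -(cvg_lim _ cB)//; apply: limr_ge.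
  by apply/cvg_ex; eexists; exact: cB.
by apply: nearW => k; exact: bound.
Qed.

Let argmin (x : T) : {set 'I_n.+1} := [set i | phi i x == C x]%SET.

Let cell (J : {set 'I_n.+1}) := [set x | argmin x = J].

Let measurable_cell J : measurable (cell J).
Proof.
rewrite (_ : cell J = \bigcap_(i in [set: 'I_n.+1])
    (if i \in J then [set x | phi i x = C x] else ~` [set x | phi i x = C x])).
  apply: fin_bigcap_measurable => // i _.
  have me := measurable_coincidence (mphi i) mC.
  by case: ifP => // _; exact: measurableC.
apply/seteqP; split=> x.
  move=> <- i _; rewrite inE; case: ifPn => /eqP //.
move=> h; apply/setP => i; have := h i Logic.I; rewrite inE.
by case: ifP => _ /eqP // /negbTE.
Qed.

Let argmin_comp_indic (h : {set 'I_n.+1} -> R) x :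
  h (argmin x) = \sum_J h J * \1_(cell J) x.
Proof.
rewrite (bigD1 (argmin x))//= indicE mem_set ?mulr1//.
rewrite big1 ?addr0// => J JI; rewrite indicE memNset ?mulr0//= => e.
by rewrite e eqxx in JI.
Qed.

Let measurable_argmin_comp (h : {set 'I_n.+1} -> R) :
  measurable_fun setT (fun x => h (argmin x)).
Proof.
under eq_fun do rewrite argmin_comp_indic.
by apply: measurable_sum => J; exact: measurable_funM.
Qed.

Let Rintegral_argmin_comp (h : {set 'I_n.+1} -> R) :
  \int[G]_x h (argmin x) = \sum_J h J * fine (G (cell J)).
Proof.
under eq_Rintegral do rewrite argmin_comp_indic.
have ci J : G.-integrable setT (EFin \o (\1_(cell J) : T -> R)).
  exact: integrable_indic.
rewrite Rintegral_sum; last first.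
  by move=> J; have := integrableZl measurableT (h J) (ci J).
apply: eq_bigr => J _; rewrite RintegralZl//.
by rewrite /Rintegral integral_indic// setIT.
Qed.

(** Only the set of minimizing indices of x matters, and it takes finitely many
    values: the cells on which it is constant are the rows of a finite Hall
    problem whose columns are the indices, with demands 1 / n.+1. *)
Lemma argmin_kernel :
  (forall A : {set 'I_n.+1},
    (#|A|%:R / n.+1%:R <= fine (G [set x | exists2 i, i \in A & phi i x = C x]))) ->
  exists pi : 'I_n.+1 -> T -> R,
    [/\ forall i, measurable_fun setT (pi i),
        forall i x, 0 <= pi i x <= 1,
        forall x, \sum_i pi i x = 1,
        forall i, \int[G]_x pi i x = n.+1%:R^-1 &
        forall i x, pi i x != 0 -> phi i x = C x].
Proof.
move=> hall.
pose g J := fine (G (cell J)).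
(* The set of minimizing indices is never empty; the empty row, of weight 0, is
   related to everything so that each row has a successor. *)
pose E (J : {set 'I_n.+1}) i := (J == finset.set0) || (i \in J).
have g0 J : 0 <= g J by rewrite fine_ge0.
have argmin0 x : argmin x != finset.set0.
  have [i e] := pwmin_attained phi x.
  by apply/set0Pn; exists i; rewrite inE /C e.
have [|||J|kap [k01 k1 kE]] := @fractional_hall R _ 'I_n.+1 g (fun=> n.+1%:R^-1) E.
- exact: g0.
- move=> J; have [->|[i iJ]] := set_0Vmem J; first by exists ord0; rewrite /E eqxx.
  by exists i; rewrite /E iJ orbT.
- have := Rintegral_argmin_comp (fun=> 1); rewrite Rintegral_cst_probability.
  under eq_bigr do rewrite mul1r.
  by rewrite -/(g _) => <-; rewrite sumr_const card_ord -[LHS]mulr_natl mulfV// pnatr_eq0.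
- rewrite sumr_const -[leLHS]mulr_natl; apply: le_trans (hall J) _.
  pose h (K : {set 'I_n.+1}) : R := [exists k in J, k \in K]%:R.
  have -> : fine (G [set x | exists2 i, i \in J & phi i x = C x]) =
      \int[G]_x h (argmin x).
    rewrite (@eq_Rintegral _ _ _ _ _
      (\1_[set x | exists2 i, i \in J & phi i x = C x])).
      rewrite /Rintegral integral_indic ?setIT//.
      rewrite (_ : [set x | _] = \bigcup_(i in [set i | i \in J]) [set x | phi i x = C x]).
        apply: fin_bigcup_measurable => // i _.
        exact: measurable_coincidence.
      by apply/seteqP; split=> x [i iA ix]; exists i.
    move=> x _; rewrite /h indicE; congr (_%:R); congr nat_of_bool.
    apply/idP/idP.
      case/existsP => i /andP[iJ]; rewrite !inE => /eqP ix.
      by exists i.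
    by rewrite inE => -[i iJ ix]; apply/existsP; exists i; rewrite iJ inE ix /=.
  rewrite Rintegral_argmin_comp [leRHS]big_mkcond; apply: ler_sum => K _.
  rewrite /h -/(g K); case: ifPn => [_|].
    by apply: ler_piMl; rewrite ?lern1 ?leq_b1//; exact: g0.
  rewrite negb_exists => /forallP nE.
  suff -> : [exists k in J, k \in K] = false by rewrite mul0r.
  apply/negbTE; rewrite negb_exists; apply/forallP => k.
  by apply: contra (nE k) => /andP[-> kK]; rewrite /E kK orbT.
exists (fun i x => kap (argmin x) i); split.
- by move=> i; exact: (measurable_argmin_comp (kap^~ i)).
- move=> i x; have /andP[-> h] := k01 (argmin x) i.
  by rewrite (le_trans h)// lern1 leq_b1.
- by move=> x; exact: k1.
- move=> i; rewrite (Rintegral_argmin_comp (kap^~ i)) -(kE i).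
  by apply: eq_bigr => J _; rewrite mulrC.
- move=> i x k0; have /andP[h0 h] := k01 (argmin x) i.
  have : E (argmin x) i.
    by apply: contraR k0 => /negbTE nE; rewrite eq_le h0 andbT (le_trans h)// nE.
  by rewrite /E (negbTE (argmin0 x)) inE => /eqP.
Qed.

End argmin_kernel.

(** * Couplings with an empirical measure *)

Section coupling_from_kernel.
Context {R : realType} {d : nat} {n : nat}.
Local Notation T := (euclid R d).
Variables (P : probability T R) (w : 'I_n.+1 -> T) (pi : 'I_n.+1 -> T -> R).
Hypotheses (mpi : forall i, measurable_fun setT (pi i))
  (pi01 : forall i x, 0 <= pi i x <= 1)
  (pi1 : forall x, \sum_i pi i x = 1)
  (piE : forall i, \int[P]_x pi i x = n.+1%:R^-1).

Let pi0 i x : 0 <= pi i x. Proof. by have /andP[] := pi01 i x. Qed.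

Let ipi i : P.-integrable setT (EFin \o pi i).
Proof.
apply: (@bounded_integrable _ _ _ _ _ 1) => // x.
by have /andP[h0 h1] := pi01 i x; rewrite ger0_norm.
Qed.

Let slice (i : 'I_n.+1) (x : T) : T * T := (x, w i).

Let mslice i : measurable_fun setT (slice i).
Proof. exact: measurable_fun_pair. Qed.

(** The part of the coupling that sends mass to the atom of index k, as a
    sequence because finite sums of measures are indexed that way. *)
Let branch (k : nat) : {measure set (T * T) -> \bar R}.
Proof.
refine (pushforward (density_measure (ipi (inord k)) (pi0 (inord k)))
  (slice (inord k))).
exact: mslice.
Defined.

Let has_density_branch i : has_density P (density_measure (ipi i) (pi0 i)) (pi i).
Proof. by split. Qed.

Let glue_integral (h : T * T -> R) : measurable_fun setT h ->
  (forall z, 0 <= h z) ->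
  (\int[msum branch n.+1]_z (h z)%:E =
   \sum_i \int[P]_x (h (x, w i) * pi i x)%:E)%E.
Proof.
move=> mh h0; rewrite ge0_integral_measure_sum//.
apply: eq_bigr => i _; rewrite ge0_integral_pushforward//.
rewrite inord_val preimage_setT.
rewrite -(ge0_integral_density (has_density_branch i) (g := fun x => h (x, w i)))//.
  exact: (measurableT_comp mh).
- exact/measurable_EFinP.
- by move=> z _; rewrite lee_fin.
- by move=> z _; rewrite lee_fin.
- exact/measurable_EFinP.
Qed.

(** Move x to the atom w i with probability pi i x. *)
Lemma coupling_of_kernel : exists G : probability (T * T)%type R,
  coupling P (empirical w) G /\
  forall h : T * T -> R, measurable_fun setT h -> (forall z, 0 <= h z) ->
    (\int[G]_z (h z)%:E = \sum_i \int[P]_x (h (x, w i) * pi i x)%:E)%E.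
Proof.
have setE B : measurable B -> msum branch n.+1 B =
    (\sum_i \int[P]_x (\1_B (x, w i) * pi i x)%:E)%E.
  move=> mB; rewrite -[B in LHS]setIT -integral_indic//.
  exact: (glue_integral (h := \1_B)).
have rowE A : measurable A -> msum branch n.+1 (A `*` setT) = P A.
  move=> mA; rewrite setE; last exact: measurableX.
  rewrite -ge0_integral_sum//; last 2 first.
    move=> i; apply/measurable_EFinP; apply: measurable_funM => //.
    have mI : measurable_fun setT (\1_(A `*` setT) : T * T -> R).
      by apply: measurable_indic; exact: measurableX.
    exact: (measurableT_comp mI (mslice i)).
    by move=> i x _; rewrite lee_fin mulr_ge0.
  rewrite -[in RHS](setIT A) -integral_indic//; apply: eq_integral => x _.
  rewrite sumEFin; congr (_%:E).
  under eq_bigr do rewrite indicE.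
  rewrite (_ : \1_A x = \sum_i \1_A x * pi i x); last by rewrite -mulr_sumr pi1 mulr1.
  by apply: eq_bigr => i _; rewrite indicE in_setX in_setT andbT.
have mass1 : msum branch n.+1 setT = 1%E.
  by rewrite -setXTT rowE//; exact: probability_setT.
have [G GE] := probability_of_measure mass1.
exists G; split; first split=> A mA.
- by rewrite GE; exact: rowE.
- rewrite GE; apply: etrans (setE _ (measurableX measurableT mA)) _.
  rewrite /= /empirical ge0_sume_distrr//; apply: eq_bigr => i _.
  have -> : n.+1%:R^-1%:E = (\int[P]_x (pi i x)%:E)%E :> \bar R.
    by rewrite -(piE i) /Rintegral fineK//; exact: integrable_fin_num (ipi i).
  rewrite diracE (eq_integral (fun x => ((w i \in A)%:R * pi i x)%:E)); last first.
    by move=> x _; rewrite indicE in_setX in_setT.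
  case: (w i \in A).
    by rewrite mule1; apply: eq_integral => x _; rewrite mul1r.
  by rewrite mule0; apply: integral0_eq => x _; rewrite mul0r.
- move=> h mh h0; rewrite -glue_integral//.
  by apply: eq_measure_integral => A mA _; exact: GE.
Qed.
End coupling_from_kernel.

(** * Marginals, transport cost and the Wasserstein constraint *)

Section euclid_measurability.
Context {R : realType} {d : nat}.
Local Notation T := (euclid R d).

Lemma measurable_euclid_set1 (y : T) : measurable [set y].
Proof.
rewrite (_ : [set y] = \bigcap_(i in [set: 'I_d])
    ((fun t : T => tnth t i) @^-1` [set tnth y i])).
  apply: fin_bigcap_measurable => // i _.
  rewrite -[X in measurable X]setTI.
  by apply: (@measurable_tnth _ _ d i) => //; exact: measurable_set1.
apply/seteqP; split=> [x -> //|x xy].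
by apply: eq_from_tnth => i; exact: xy.
Qed.

End euclid_measurability.

Section marginals.
Context {R : realType} {d : nat}.
Local Notation T := (euclid R d).
Variables (P Q : probability T R) (G : probability (T * T)%type R).
Hypothesis cG : coupling P Q G.
Implicit Types g : T -> R.

Lemma ge0_integral_fst g : measurable_fun setT g -> (forall x, 0 <= g x) ->
  (\int[G]_z (g z.1)%:E = \int[P]_x (g x)%:E)%E.
Proof.
move=> mg g0; have mg' : measurable_fun setT (EFin \o g) by exact/measurable_EFinP.
transitivity (\int[pushforward G fst]_x (EFin \o g) x)%E.
  rewrite ge0_integral_pushforward//.
  by move=> x _; rewrite lee_fin.
apply: eq_measure_integral => A mA _; apply: etrans (cG.1 _ mA); rewrite /pushforward.
by congr (G _); apply/seteqP; split=> [z //|z []].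
Qed.

Lemma ge0_integral_snd g : measurable_fun setT g -> (forall x, 0 <= g x) ->
  (\int[G]_z (g z.2)%:E = \int[Q]_x (g x)%:E)%E.
Proof.
move=> mg g0; have mg' : measurable_fun setT (EFin \o g) by exact/measurable_EFinP.
transitivity (\int[pushforward G snd]_x (EFin \o g) x)%E.
  rewrite ge0_integral_pushforward//.
  by move=> x _; rewrite lee_fin.
apply: eq_measure_integral => A mA _; apply: etrans (cG.2 _ mA); rewrite /pushforward.
by congr (G _); apply/seteqP; split=> [z //|z []].
Qed.

End marginals.

Lemma ge0_integral_empirical {R : realType} {d n : nat}
    (w : 'I_n.+1 -> euclid R d) (g : euclid R d -> R) :
  measurable_fun setT g -> (forall x, 0 <= g x) ->
  (\int[empirical w]_x (g x)%:E = (n.+1%:R^-1 * \sum_i g (w i))%:E)%E.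
Proof.
move=> mg g0; have mg' : measurable_fun setT (EFin \o g) by exact/measurable_EFinP.
have n0 : 0 <= n.+1%:R^-1 :> R by rewrite invr_ge0.
pose ds k : {measure set (euclid R d) -> \bar R} := \d_(w (inord k)).
transitivity (\int[mscale (NngNum n0) (msum ds n.+1)]_x (g x)%:E)%E.
  apply: eq_measure_integral => A mA _; rewrite /= /mscale /= /msum /empirical /=.
  by congr (_ * _)%E; apply: eq_bigr => i _; rewrite inord_val.
rewrite ge0_integral_mscale//; last by move=> x _; rewrite lee_fin.
rewrite ge0_integral_measure_sum//; last by move=> x _; rewrite lee_fin.
rewrite EFinM -sumEFin; congr (_ * _)%E; apply: eq_bigr => i _.
by rewrite integral_dirac// diracT mul1e inord_val.
Qed.

Section transport_cost.
Context {R : realType} {d : nat}.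
Local Notation T := (euclid R d).
Variables (X : set T) (c : T -> T -> R) (s : R).
Hypotheses (mX : measurable X)
  (mc : measurable_fun (X `*` X) (fun z => c z.1 z.2)) (s1 : 1 <= s).

(** The cost extended by 0 outside the observation space, where the metric is
    unconstrained; this makes it measurable on the whole space. *)
Definition costX (z : T * T) : R :=
  if z \in X `*` X then c z.1 z.2 `^ s else 0.

Lemma costX_ge0 z : 0 <= costX z.
Proof. by rewrite /costX; case: ifP => // _; exact: powR_ge0. Qed.

Lemma costXE x y : X x -> X y -> costX (x, y) = c x y `^ s.
Proof. by move=> Xx Xy; rewrite /costX mem_set. Qed.

Lemma measurable_costX : measurable_fun setT costX.
Proof.
have mXX : measurable (X `*` X) by exact: measurableX.
have h : measurable_fun (X `*` X) (fun z => c z.1 z.2 `^ s).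
  exact: (measurableT_comp (measurable_powR s) mc).
exact: (measurable_restrictT _ mXX).1 h.
Qed.

Lemma integral_costX (G : {measure set (T * T) -> \bar R}) :
  (\int[G]_(z in X `*` X) (c z.1 z.2 `^ s)%:E = \int[G]_z (costX z)%:E)%E.
Proof.
rewrite integral_mkcond; apply: eq_integral => z _.
by rewrite /costX patchE; case: ifP.
Qed.

Let s0 : 0 < s. Proof. exact: lt_le_trans s1. Qed.

Let inf_ge0 (P Q : probability T R) :
  (0 <= ereal_inf [set \int[G]_(z in X `*` X) (c z.1 z.2 `^ s)%:E
                  | G in coupling P Q])%E.
Proof.
apply: le_ereal_inf_tmp => _ [G _ <-]; apply: integral_ge0 => z _.
by rewrite lee_fin powR_ge0.
Qed.

Lemma wasserstein_le (P Q : probability T R) (G : probability (T * T)%type R) r :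
  0 <= r -> coupling P Q G -> (\int[G]_z (costX z)%:E <= (r `^ s)%:E)%E ->
  (wasserstein X c s P Q <= r%:E)%E.
Proof.
move=> r0 PQG Gr.
have : (ereal_inf [set \int[G]_(z in X `*` X) (c z.1 z.2 `^ s)%:E
                  | G in coupling P Q] <= (r `^ s)%:E)%E.
  apply: le_trans Gr; rewrite -integral_costX.
  by apply: ereal_inf_lbound; exists G.
move=> /(@gt0_ler_poweR _ s^-1) h; rewrite /wasserstein.
apply: le_trans (h _ _ _) _.
- by rewrite invr_ge0 ltW.
- by rewrite in_itv/= inf_ge0 leey.
- by rewrite in_itv/= lee_fin powR_ge0 leey.
- by rewrite poweR_EFin -powRrM divff ?gt_eqF// powRr1.
Qed.

(** The distance is an infimum over couplings that need not be attained, hence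
    the error e. *)
Lemma wasserstein_near_optimal (P Q : probability T R) r e :
  0 <= r -> 0 < e -> (wasserstein X c s P Q <= r%:E)%E ->
  exists2 G : probability (T * T)%type R, coupling P Q G &
    (\int[G]_z (costX z)%:E <= (r `^ s + e)%:E)%E.
Proof.
move=> r0 e0 /(@gt0_ler_poweR _ s) h.
have : (ereal_inf [set \int[G]_(z in X `*` X) (c z.1 z.2 `^ s)%:E
                  | G in coupling P Q] < (r `^ s + e)%:E)%E.
  have := h (ltW s0); rewrite !in_itv /= poweR_ge0 !leey lee_fin r0 => /(_ isT isT).
  rewrite -poweRrM mulVf ?gt_eqF// poweRe1// => /le_lt_trans; apply.
  by rewrite lte_fin ltrDl.
move=> /ereal_inf_lt[_ [G PQG <-]] lt; exists G => //.
by rewrite -integral_costX ltW.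
Qed.

End transport_cost.

(** * Weak duality *)

Section weak_duality.
Context {R : realType} {d n : nat}.
Local Notation T := (euclid R d).
Variables (X : set T) (c : T -> T -> R) (s : R) (w : 'I_n.+1 -> T).
Hypotheses (mX : measurable X)
  (mc : measurable_fun (X `*` X) (fun z => c z.1 z.2)) (s1 : 1 <= s).

Definition cost_to (i : 'I_n.+1) (x : T) : R := costX X c s (x, w i).

Lemma measurable_cost_to i : measurable_fun setT (cost_to i).
Proof.
apply: (measurableT_comp (measurable_costX s mX mc)).
exact: measurable_fun_pair.
Qed.

(** On the support of a coupling with the empirical measure, the second
    coordinate is an atom y and C(x) <= lam c^s(x,y) + U(y), where U(y) is the
    least value of - u i over the indices i of the atom y.  Integrating gives
    the bound, since U (w i) <= - u i.  Atoms may coincide, which is why the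
    potential on the atoms has to be a minimum over indices.  Adding M makes
    all integrands nonnegative, so that their integrals exist. *)
Lemma weak_duality (P : probability T R) (r lam M : R) (u : 'I_n.+1 -> R) :
  0 <= r -> 0 <= lam -> P X = 1%E -> (forall i, `|u i| <= M) ->
  (wasserstein X c s P (empirical w) <= r%:E)%E ->
  (\int[P]_x (pwmin (reduced_cost cost_to lam u) x + M)%:E <=
     (lam * r `^ s - n.+1%:R^-1 * \sum_i u i + M)%:E)%E.
Proof.
move=> r0 lam0 PX uM Wr.
have uM1 i : - M <= - u i <= M by rewrite -ler_norml normrN.
(* Away from the atoms U takes the harmless value M. *)
pose U := pwmin (fun i (y : T) => if y \in [set w i] then - u i else M).
have mU : measurable_fun setT U.
  apply: measurable_pwmin => i; apply: measurable_fun_ifT => //.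
  apply: (@measurable_fun_bool _ _ _ _ true); rewrite setTI.
  rewrite (_ : _ @^-1` _ = [set w i]); first exact: measurable_euclid_set1.
  by apply/seteqP; split=> y; [move=> /set_mem|move=> yw; exact: mem_set].
have UM y : 0 <= U y + M.
  rewrite -lerBlDr sub0r le_pwmin// => i; case: ifP => _.
    by have /andP[] := uM1 i.
  by have /andP[h1 h2] := uM1 i; exact: le_trans h1 h2.
have Uw i : U (w i) <= - u i.
  by apply: le_trans (pwmin_le _ i _) _; rewrite mem_set.
have mC := measurable_pwmin (fun i => measurable_reduced_cost lam u (measurable_cost_to i)).
have CM x : 0 <= pwmin (reduced_cost cost_to lam u) x + M.
  rewrite -lerBlDr sub0r le_pwmin// => i; rewrite /reduced_cost /cost_to.
  have /andP[h _] := uM1 i; apply: le_trans h _.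
  by rewrite lerDr mulr_ge0// costX_ge0.
have CU x i : X x -> pwmin (reduced_cost cost_to lam u) x <= lam * costX X c s (x, w i) + U (w i).
  move=> Xx; rewrite /U; have [j ->] := pwmin_attained
    (fun i (y : T) => if y \in [set w i] then - u i else M) (w i).
  case: ifPn => [|_].
    by rewrite inE => ->; exact: pwmin_le.
  apply: le_trans (pwmin_le _ i _) _.
  by rewrite /reduced_cost /cost_to lerD2l; have /andP[] := uM1 i.
apply/lee_addgt0Pr => e e0.
have e1 : 0 < e / (lam + 1) by rewrite divr_gt0// ltr_wpDl.
have [G cG Gcost] := wasserstein_near_optimal s1 r0 e1 Wr.
rewrite -(ge0_integral_fst cG) //; last exact: measurable_funD.
pose W := \bigcup_(i in [set: 'I_n.+1]) [set w i].
have mW : measurable W.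
  by apply: fin_bigcup_measurable => // i _; exact: measurable_euclid_set1.
have XW0 : G (~` (X `*` W)) = 0%E.
  have X0 : G (~` X `*` setT) = 0%E.
    apply: etrans (cG.1 _ (measurableC mX)) _.
    by rewrite probability_setC// PX subee.
  have W0 : G (setT `*` ~` W) = 0%E.
    apply: etrans (cG.2 _ (measurableC mW)) _.
    rewrite /= /empirical big1 ?mule0// => i _.
    by rewrite diracE memNset// => -[]; exists i.
  apply/eqP; rewrite eq_le measure_ge0 andbT.
  rewrite -[leRHS](adde0 0%E) -[X in (_ <= X + _)%E]X0 -[X in (_ <= _ + X)%E]W0.
  apply: le_trans (measureU2 _ _ _); [|exact: measurableX (measurableC mX) measurableT
    |exact: measurableX measurableT (measurableC mW)].
  apply: le_measure; rewrite ?inE.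
  - by apply: measurableC; exact: measurableX.
  - by apply: measurableU; apply: measurableX => //; exact: measurableC.
  - move=> [x y] /= /not_andP[nX|nW]; [by left|by right].
have step : (\int[G]_z (pwmin (reduced_cost cost_to lam u) z.1 + M)%:E <=
    \int[G]_z (lam * costX X c s z + (U z.2 + M))%:E)%E.
  apply: ae_ge0_le_integral => //.
  - by move=> z _; rewrite lee_fin.
  - apply/measurable_EFinP; apply: measurable_funD => //.
    exact: (measurableT_comp mC measurable_fst).
  - by move=> z _; rewrite lee_fin addr_ge0// mulr_ge0// costX_ge0.
  - apply/measurable_EFinP; apply: measurable_funD.
      by apply: measurable_funM => //; exact: measurable_costX.
    by apply: measurable_funD => //; exact: (measurableT_comp mU measurable_snd).
  exists (~` (X `*` W)); split=> //.
    by apply: measurableC; exact: measurableX.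
  move=> [x y] /= h [Xx [i _ /= yw]]; apply: h => _.
  by rewrite lee_fin addrA lerD2r yw; exact: CU.
apply: le_trans step _.
under eq_integral do rewrite EFinD EFinM.
rewrite ge0_integralD//; last 4 first.
- by move=> z _; rewrite -EFinM lee_fin mulr_ge0// costX_ge0.
- apply: emeasurable_funM => //; apply/measurable_EFinP.
  exact: measurable_costX.
- by move=> z _; rewrite lee_fin.
- apply/measurable_EFinP; apply: measurable_funD => //.
  exact: (measurableT_comp mU measurable_snd).
rewrite ge0_integralZl//; last 2 first.
- by apply/measurable_EFinP; exact: measurable_costX.
- by move=> z _; rewrite lee_fin costX_ge0.
rewrite (ge0_integral_snd cG (g := fun y => U y + M))//; last exact: measurable_funD.
rewrite ge0_integral_empirical//; last exact: measurable_funD.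
have e2 : (lam%:E * (\int[G]_z (costX X c s z)%:E) <= (lam * r `^ s + e)%:E)%E.
  apply: le_trans (lee_wpmul2l _ Gcost) _; rewrite ?lee_fin//.
  rewrite mulrDr lerD2l mulrCA ler_piMr ?(ltW e0)//.
  by rewrite ler_pdivrMr ?ltr_wpDl// mul1r lerDl.
apply: le_trans (leeD2r _ e2) _; rewrite -!EFinD lee_fin.
have : n.+1%:R^-1 * \sum_i (U (w i) + M) <= n.+1%:R^-1 * \sum_(i < n.+1) (- u i + M).
  by rewrite ler_wpM2l ?invr_ge0// ler_sum// => i _; rewrite lerD2r.
rewrite [in leRHS]big_split/= sumr_const card_ord sumrN.
rewrite -[M *+ _]mulr_natl mulrDr mulrN.
rewrite mulKf ?pnatr_eq0// => h.
apply: le_trans (lerD (lexx (lam * r `^ s + e)) h) _.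
by rewrite le_eqVlt; apply/orP; left; apply/eqP; ring.
Qed.

End weak_duality.

(** * Kullback-Leibler divergence and Gibbs' inequality *)

Section kullback_leibler.
Context {R : realType} {d : nat}.
Local Notation T := (euclid R d).
Implicit Types P Q G : probability T R.

Lemma measurable_lne_fin (f : T -> \bar R) : measurable_fun setT f ->
  (forall x, f x \is a fin_num) -> measurable_fun setT (fun x => lne (f x)).
Proof.
move=> mf ff.
have mff : measurable_fun setT (fine \o f).
  exact: (measurableT_comp (fine_measurable measurableT) mf).
rewrite (_ : (fun x => lne (f x)) =
    (fun x => if fine (f x) <= 0 then -oo%E else (ln (fine (f x)))%:E)).
  apply: measurable_fun_ifT => //; first exact: measurable_fun_ler.
  by apply/measurable_EFinP; exact: (measurableT_comp (@measurable_ln R) mff).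
by apply/funext => x; rewrite -{1}(fineK (ff x)).
Qed.

(** The set where the density vanishes is null for the measure it defines;
    hence ln h, which is a junk value where h = 0, represents the logarithm of
    the density almost everywhere. *)
Lemma density_gt0_ae P Q h : has_density Q P h -> {ae P, forall x, 0 < h x}.
Proof.
move=> [mh h0 hE].
have mZ : measurable [set x | h x = 0].
  by apply: measurable_coincidence => //; exact: measurable_cst.
exists [set x | h x = 0]; split=> //.
  by rewrite hE//; apply: integral0_eq => x /= ->.
move=> x /= hx; apply: contrapT => /eqP hx0; apply: hx.
by rewrite lt_def hx0 h0.
Qed.

Lemma KL_density P Q h : has_density Q P h ->
  KL P Q = (\int[P]_x (ln (h x))%:E)%E.
Proof.
move=> PQh; have PQ := has_density_dominates PQh; have [mh h0 hE] := PQh.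
rewrite /KL; case: pselect => // PQ'.
set D := Radon_Nikodym _ _.
have DE : ae_eq Q setT D (EFin \o h).
  apply: ae_eq_trans (ae_eq_sym (ae_eq_Radon_Nikodym_SigmaFinite PQ measurableT)) _.
  exact: density_ae_Radon_Nikodym PQh.
have DE' : ae_eq P setT D (EFin \o h).
  case: DE => N [mN N0 sub]; exists N; split=> //.
  exact: ((null_content_dominatesP _ _).1 PQ).
have mD : measurable_fun setT D.
  by have /integrableP[] :=
    @Radon_Nikodym_integrable _ _ _ (charge_of_finite_measure P) Q PQ.
apply: ae_eq_integral => //.
- by apply: measurable_lne_fin => // x; exact: Radon_Nikodym_fin_num.
- by apply/measurable_EFinP; exact: (measurableT_comp (@measurable_ln R) mh).
- apply: filterS2 DE' (density_gt0_ae PQh) => x /(_ Logic.I) -> hx _ /=.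
  by rewrite leNgt hx.
Qed.

Lemma KL_fin_density P Q : (KL P Q < +oo)%E -> exists h, has_density Q P h.
Proof.
rewrite /KL; case: pselect => // PQ _.
exists (fine \o Radon_Nikodym_SigmaFinite.f P Q); split=> [|x|A mA].
- apply: (measurableT_comp (fine_measurable measurableT)).
  exact: measurable_int (Radon_Nikodym_SigmaFinite.f_integrable PQ).
- by rewrite fine_ge0// Radon_Nikodym_SigmaFinite.f_ge0.
- apply: etrans (Radon_Nikodym_SigmaFinite.f_integral PQ mA) _.
  apply: eq_integral => x _.
  by rewrite fineK// Radon_Nikodym_SigmaFinite.f_fin_num.
Qed.

(** Equality case of Gibbs' inequality.  Put y = ln h - phi, the logarithm of
    dP/dG.  Then exp(-y) has P-integral at most 1 and y has nonpositive
    P-integral, so the nonnegative function exp(-y) - 1 + y has P-integral at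
    most 0.  Thus y = 0 almost everywhere, which makes P at most G, and two
    ordered probabilities are equal.  The integrability of ln h is part of
    what must be proved: its negative part is controlled by
    exp(-y) + |phi|, its positive part by the bound on the divergence. *)
Lemma gibbs_unique P Q G (phi : T -> R) (k : R) : measurable_fun setT phi ->
  has_density Q G (expR \o phi) ->
  P.-integrable setT (EFin \o phi) ->
  (KL P Q <= k%:E)%E -> k <= \int[P]_x phi x ->
  forall A, measurable A -> P A = G A.
Proof.
move=> mphi QG iphi KLk kphi.
have [h PQh] : exists h, has_density Q P h.
  by apply: KL_fin_density; exact: le_lt_trans (ltry k).
have [mh h0 hE] := PQh; have [_ _ GE] := QG.
pose l x := ln (h x).
have ml : measurable_fun setT l by exact: (measurableT_comp (@measurable_ln R) mh).
pose y x := l x - phi x.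
have my : measurable_fun setT y by exact: measurable_funB.
have mey : measurable_fun setT (fun x => expR (- y x)).
  by apply: measurableT_comp => //; exact: measurable_funN.
have ey1 : (\int[P]_x (expR (- y x))%:E <= 1)%E.
  rewrite (ge0_integral_density PQh)//.
  have <- : (\int[Q]_x (expR (phi x))%:E)%E = 1%E.
    by apply: etrans (esym (GE _ measurableT)) _; exact: probability_setT.
  apply: ge0_le_integral => //.
  - by move=> x _; rewrite lee_fin mulr_ge0// expR_ge0.
  - by apply/measurable_EFinP; exact: measurable_funM.
  - by apply/measurable_EFinP; exact: measurableT_comp.
  - move=> x _; rewrite lee_fin /y /l opprB expRD expRN.
    have [hx|hx] := eqVneq (h x) 0; first by rewrite hx mulr0 expR_ge0.
    by rewrite lnK ?posrE ?lt_def ?hx ?h0// divfK.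
have iey : P.-integrable setT (EFin \o (fun x => expR (- y x))).
  apply/integrableP; split; first exact/measurable_EFinP.
  apply: (@le_lt_trans _ _ 1%E); last exact: ltry.
  rewrite (eq_integral (EFin \o (fun x => expR (- y x))))//.
  by move=> x _ /=; rewrite ger0_norm// expR_ge0.
have il : P.-integrable setT (EFin \o l).
  have mel : measurable_fun setT (EFin \o l) by exact/measurable_EFinP.
  have inb : P.-integrable setT (EFin \o (fun x => expR (- y x) + `|phi x|)).
    have := integrableD measurableT iey (integrable_norm iphi).
    by apply: eq_integrable.
  have lneg : (\int[P]_x ((EFin \o l)^\- x) < +oo)%E.
    have /integrableP[_] := inb; apply: le_lt_trans.
    apply: ge0_le_integral => //.
    - exact: measurable_funeneg.
    - by apply: measurableT_comp => //; exact: measurable_int inb.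
    - move=> x _; rewrite funenegE /= /y -EFin_max lee_fin ge_max normr_ge0 andbT.
      rewrite ger0_norm ?addr_ge0 ?expR_ge0//.
      have := expR_ge1Dx (- (l x - phi x)); have := ler_norm (- phi x).
      rewrite normrN; lra.
  have lpos : (\int[P]_x ((EFin \o l)^\+ x) < +oo)%E.
    move: KLk; rewrite (KL_density PQh) integralE.
    set a := (\int[P]_x (_^\+ x))%E; set b := (\int[P]_x (_^\- x))%E.
    have fb : b \is a fin_num.
      by rewrite ge0_fin_numE//; apply: integral_ge0 => x _; exact: funeneg_ge0.
    by rewrite leeBlDr// => /le_lt_trans; apply; rewrite -(fineK fb) -EFinD ltry.
  apply/integrableP; split => //.
  rewrite (eq_integral ((EFin \o l)^\+ \+ (EFin \o l)^\-)%E); last first.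
    by move=> x _; exact: (congr1 (@^~ x) (fune_abse (EFin \o l))).
  rewrite ge0_integralD//; first by rewrite lte_add_pinfty.
  - exact: measurable_funepos.
  - exact: measurable_funeneg.
have iy : P.-integrable setT (EFin \o y).
  by have := integrableB measurableT il iphi; apply: eq_integrable.
pose Z x := expR (- y x) - 1 + y x.
have Z0 x : 0 <= Z x by have := expR_ge1Dx (- y x); rewrite /Z; lra.
have mZ : measurable_fun setT Z.
  by apply: measurable_funD => //; exact: measurable_funB.
have i1 : P.-integrable setT (EFin \o (fun=> 1 : R)).
  exact: finite_measure_integrable_cst.
have iey1 : P.-integrable setT (EFin \o (fun x => expR (- y x) - 1)).
  by have := integrableB measurableT iey i1; apply: eq_integrable.
have iZ : P.-integrable setT (EFin \o Z).
  by have := integrableD measurableT iey1 iy; apply: eq_integrable.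
have intl : \int[P]_x l x <= k.
  rewrite -lee_fin fineK ?integrable_fin_num//; first by rewrite -(KL_density PQh).
have intZ : \int[P]_x Z x <= 0.
  rewrite /Z RintegralD// RintegralB// RintegralB// Rintegral_cst_probability.
  have : \int[P]_x expR (- y x) <= 1.
    by rewrite -lee_fin fineK ?integrable_fin_num.
  lra.
have Zae : ae_eq P setT (EFin \o Z) (cst 0%E).
  apply/ae_eq_integral_abs => //; first exact/measurable_EFinP.
  apply/eqP; rewrite eq_le integral_ge0// andbT.
  have -> : (\int[P]_x `|(EFin \o Z) x| = (\int[P]_x Z x)%:E)%E.
    rewrite fineK ?integrable_fin_num//.
    by apply: eq_integral => x _ /=; rewrite ger0_norm.
  by rewrite lee_fin.
have [N [mN N0 NE]] := Zae.
have le A : measurable A -> (P A <= G A)%E.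
  move=> mA.
  have mW : measurable ([set x | h x = 0] `|` N).
    apply: measurableU => //.
    by apply: measurable_coincidence => //; exact: measurable_cst.
  have W0 : P ([set x | h x = 0] `|` N) = 0%E.
    have [N' [mN' N'0 sub]] := density_gt0_ae PQh.
    apply: (@subset_measure0 _ _ _ P _ (N' `|` N)) => //.
    - exact: measurableU.
    - by apply: setSU => x /= hx; apply: sub => /=; rewrite hx ltxx.
    - by apply: null_set_setU.
  have AW0 : P (A `&` ([set x | h x = 0] `|` N)) = 0%E.
    apply: (@subset_measure0 _ _ _ P _ _ _ _ _ W0) => //.
    exact: measurableI.
  have -> : P A = P (A `\` ([set x | h x = 0] `|` N)).
    have PA : (P A < +oo)%E by exact: le_lt_trans (probability_le1 P mA) (ltry 1).
    apply/esym/(etrans (measureD mA mW PA))/(etrans _ (sube0 _)).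
    by congr (_ - _)%E; exact: AW0.
  rewrite hE; last exact: measurableD.
  rewrite GE//.
  rewrite (eq_integral (fun x => (expR (phi x))%:E)).
    apply: ge0_subset_integral => //.
    - exact: measurableD.
    - by apply/measurable_EFinP; apply: measurable_funTS; exact: measurableT_comp.
  move=> x; rewrite inE => -[_] /not_orP[/eqP hx Nx].
  have Zx0 : Z x = 0.
    apply/eqP; move: Nx; apply: contra_notT => Zx; apply: NE => /=.
    by move=> /(_ Logic.I) [/eqP]; rewrite (negbTE Zx).
  have yx : y x = 0.
    apply/eqP; apply: contraT => y0.
    have := @expR_gt1Dx R (- y x); rewrite oppr_eq0 => /(_ y0).
    move/eqP: Zx0; rewrite /Z -addrA addr_eq0 [- (-1 + _)]opprD opprK => /eqP ->.
    by rewrite ltxx.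
  have -> : phi x = l x by move/eqP: yx; rewrite subr_eq0 => /eqP.
  by rewrite /l lnK// posrE lt_def hx h0.
move=> A mA; apply/eqP; rewrite eq_le le//=.
have := le _ (measurableC mA).
rewrite !probability_setC//.
have fP : P A \is a fin_num by exact: fin_num_measure.
have fG : G A \is a fin_num by exact: fin_num_measure.
by rewrite -(fineK fP) -(fineK fG) -!EFinB !lee_fin lerD2l lerN2.
Qed.

End kullback_leibler.

(** * Laplace transforms near 0 *)

(** (1 - exp(- l M)) / l tends to M as l decreases to 0, so a first-order bound
    on the Laplace transform bounds the mean of M.  Truncating M at N makes the
    second-order remainder finite; monotone convergence removes the
    truncation, and gives the integrability of M as well. *)
Lemma integral_le_of_laplace {R : realType} {d} {T : measurableType d}
    (P : probability T R) (M : T -> R) (b k : R) :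
  measurable_fun setT M -> (forall x, - b <= M x) ->
  (forall l, 0 < l -> 1 - l * k <= \int[P]_x expR (- (l * M x))) ->
  P.-integrable setT (EFin \o M) /\ \int[P]_x M x <= k.
Proof.
move=> mM Mb laplace.
pose MN (N : nat) x := Num.min (M x) N%:R.
have mMN N : measurable_fun setT (MN N) by exact: measurable_minr.
have b0 N x : - `|b| <= MN N x.
  rewrite le_min (le_trans _ (Mb x)) ?lerN2 ?ler_norm//=.
  by rewrite (le_trans _ (ler0n _ _))// oppr_le0.
pose B N : R := `|b| + N%:R.
have MNB N x : `|MN N x| <= B N.
  rewrite ler_norml; apply/andP; split.
    by apply: le_trans (b0 N x); rewrite lerN2 lerDl.
  by rewrite (@le_trans _ _ N%:R) ?ge_min ?lexx ?orbT// lerDr.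
have iMN N : P.-integrable setT (EFin \o MN N).
  exact: bounded_integrable (mMN N) (MNB N).
have trunc N : \int[P]_x MN N x <= k.
  apply/ler_addgt0Pr => e e0.
  pose K := B N ^+ 2 * expR (B N).
  have K0 : 0 <= K by rewrite mulr_ge0 ?sqr_ge0 ?expR_ge0.
  (* Small enough for the remainder l * K to stay below e. *)
  pose l := Num.min 1 (e / (K + 1)).
  have l0 : 0 < l by rewrite lt_min ltr01 divr_gt0// ltr_wpDl.
  have l1 : l <= 1 by rewrite ge_min lexx.
  have lK : l * K <= e.
    apply: (@le_trans _ _ (l * (K + 1))); first by rewrite ler_wpM2l ?(ltW l0)// lerDl.
    by rewrite -ler_pdivlMr ?ltr_wpDl// ge_min lexx orbT.
  have ptw x : expR (- (l * M x)) <= 1 - l * MN N x + l ^+ 2 * K.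
    apply: (@le_trans _ _ (expR (- (l * MN N x)))).
      by rewrite ler_expR lerN2 ler_pM2l// ge_min lexx.
    have := expR_sub1_le_quad (- (l * MN N x)).
    rewrite sqrrN exprMn normrN normrM (gtr0_norm l0) -mulrA.
    have : MN N x ^+ 2 * expR (l * `|MN N x|) <= K.
      apply: ler_pM; rewrite ?sqr_ge0 ?expR_ge0//.
        by rewrite -ler_sqrt ?sqr_ge0// !sqrtr_sqr (ger0_norm (le_trans _ (MNB N x))).
      by rewrite ler_expR (le_trans _ (MNB N x))// ler_piMl.
    move=> /(ler_wpM2l (sqr_ge0 l)); lra.
  have ie : P.-integrable setT (EFin \o (fun x => expR (- (l * M x)))).
    apply: (@bounded_integrable _ _ _ _ _ (expR (l * `|b|))).
      apply: measurableT_comp => //; apply: measurable_funN.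
      exact: measurable_funM.
    move=> x; rewrite ger0_norm ?expR_ge0// ler_expR -mulrN ler_pM2l//.
    by rewrite lerNl (le_trans _ (Mb x))// lerN2 ler_norm.
  have ilM : P.-integrable setT (EFin \o (fun x => l * MN N x)).
    by have := integrableZl measurableT l (iMN N); apply: eq_integrable.
  have ic (z : R) : P.-integrable setT (EFin \o (fun=> z)).
    exact: finite_measure_integrable_cst.
  have i1 : P.-integrable setT (EFin \o (fun x => 1 - l * MN N x)).
    by have := integrableB measurableT (ic 1) ilM; apply: eq_integrable.
  have : \int[P]_x expR (- (l * M x)) <= \int[P]_x (1 - l * MN N x + l ^+ 2 * K).
    apply: le_Rintegral => //.
    by have := integrableD measurableT i1 (ic (l ^+ 2 * K)); apply: eq_integrable.
  rewrite RintegralD// RintegralB// RintegralZl// !Rintegral_cst_probability.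
  move=> /(le_trans (laplace l l0)) h.
  have : l * \int[P]_x MN N x <= l * (k + l * K).
    by move: h; rewrite expr2; lra.
  by rewrite ler_pM2l// => /le_trans; apply; rewrite lerD2l.
have Mb0 x : 0 <= M x + `|b|.
  by rewrite -lerBlDr sub0r (le_trans _ (Mb x))// lerN2 ler_norm.
have cvgM : (\int[P]_x (MN N x + `|b|)%:E)%E @[N --> \oo] -->
    (\int[P]_x (M x + `|b|)%:E)%E.
  rewrite [X in _ --> X](_ : _ =
      (\int[P]_x limn (fun N => (MN N x + `|b|)%:E))%E); last first.
    apply: eq_integral => x _; apply/esym/cvg_lim => //.
    apply: cvg_near_cst; near=> N; rewrite /MN min_l//.
    near: N; exists (Num.truncn (M x)).+1 => //= j jM.
    by apply: le_trans (ltW (truncnS_gt _)) _; rewrite ler_nat.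
  apply: cvg_monotone_convergence => //.
  - move=> N; apply/measurable_EFinP; exact: measurable_funD.
  - by move=> N x _; rewrite lee_fin -lerBlDr sub0r.
  - move=> x _ i j ij; rewrite lee_fin lerD2r /MN le_min ge_min lexx/=.
    by rewrite ge_min ler_nat ij orbT.
have le1 : (\int[P]_x (M x + `|b|)%:E <= (k + `|b|)%:E)%E.
  rewrite -(cvg_lim _ cvgM)//; apply: lime_le; first by apply/cvg_ex; eexists; exact: cvgM.
  apply: nearW => N.
  have ib : P.-integrable setT (EFin \o (fun=> `|b|)).
    exact: finite_measure_integrable_cst.
  have iD : P.-integrable setT (EFin \o (fun x => MN N x + `|b|)).
    by have := integrableD measurableT (iMN N) ib; apply: eq_integrable.
  have := trunc N; rewrite -(lerD2r `|b|) -[in X in X -> _](Rintegral_cst_probability P `|b|).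
  by rewrite -RintegralD// -lee_fin fineK ?integrable_fin_num// Rintegral_cst_probability.
have ib : P.-integrable setT (EFin \o (fun=> `|b|)).
  exact: finite_measure_integrable_cst.
have iMb : P.-integrable setT (EFin \o (fun x => M x + `|b|)).
  apply/integrableP; split; first by apply/measurable_EFinP; exact: measurable_funD.
  rewrite (eq_integral (EFin \o (fun x => M x + `|b|))).
    exact: le_lt_trans le1 (ltry _).
  by move=> x _ /=; rewrite ger0_norm.
have iM : P.-integrable setT (EFin \o M).
  have := integrableB measurableT iMb ib; apply: eq_integrable => // x _ /=.
  by rewrite -EFinB addrK.
split=> //; rewrite -(lerD2r `|b|) -[leLHS](_ : \int[P]_x (M x + `|b|) = _).
  by rewrite -lee_fin fineK ?integrable_fin_num.
by rewrite RintegralD// Rintegral_cst_probability.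
Unshelve. all: by end_near. Qed.

(** * The semidiscrete Kantorovich problem *)

Lemma dist_coord_continuous {R : realType} (I : eqType) (a : R) (i : I) :
  continuous (fun v : prod_topology (fun _ : I => R) => `|v i - a|).
Proof.
have ci : continuous (fun v : prod_topology (fun _ : I => R) => v i).
  exact: proj_continuous.
have cs : continuous (fun v : prod_topology (fun _ : I => R) => v i - a).
  by move=> v; exact: (cvgB (@ci v) (cvg_cst a)).
move=> v.
exact: (@cvg_comp _ _ _ (fun v : prod_topology (fun _ : I => R) => v i - a) 
  (fun x : R => `|x|) _ _ _ (@cs v) (@norm_continuous R R (v i - a))).
Qed.

Lemma lipschitz_coord_continuous {R : realType} (I : eqType) (r : seq I) (k : R)
    (K : prod_topology (fun _ : I => R) -> R) :
  (forall v v', K v - K v' <= k * \sum_(i <- r) `|v i - v' i|) ->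
  continuous K.
Proof.
move=> lip v0.
pose g (v : prod_topology (fun _ : I => R)) : R := k * \sum_(i <- r) `|v i - v0 i|.
have gc : g v @[v --> v0] --> (0 : R).
  have g0 : g v0 = 0.
    by rewrite /g big1 ?mulr0// => i _; rewrite subrr normr0.
  rewrite -g0.
  have h : continuous (fun v : prod_topology (fun _ : I => R) => \sum_(i <- r) `|v i - v0 i|).
    by apply: continuous_sum_coord => i; exact: dist_coord_continuous.
  exact: (cvgM (cvg_cst k) (@h v0)).
have lo : K v0 - g v @[v --> v0] --> K v0.
  rewrite -[X in _ --> X]subr0; exact: (cvgB (cvg_cst (K v0)) gc).
have hi : K v0 + g v @[v --> v0] --> K v0.
  rewrite -[X in _ --> X]addr0; exact: (cvgD (cvg_cst (K v0)) gc).
have sq : \forall v \near nbhs v0, K v0 - g v <= K v <= K v0 + g v.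
  apply: nearW => v; rewrite lerBlDr addrC -lerBlDr -[X in _ && X]lerBlDl.
  rewrite lip andbT (le_trans (lip v0 v))// /g.
  by under eq_bigr do rewrite distrC.
exact: (squeeze_cvgr sq lo hi).
Qed.

Section semidiscrete.
Context {R : realType} {d} {T : measurableType d} {n : nat}.
Variables (P : probability T R) (f : 'I_n.+1 -> T -> R).
Hypotheses (fi : forall i, P.-integrable setT (EFin \o f i))
  (f0 : forall i x, 0 <= f i x).

Let shifted (v : 'I_n.+1 -> R) i x := f i x - v i.

(** The semi-dual of the transport problem from P to the uniform measure on the
    indices, for the costs f. *)
Definition kantorovich (v : 'I_n.+1 -> R) : R :=
  n.+1%:R^-1 * \sum_i v i + \int[P]_x pwmin (shifted v) x.

Let mf i : measurable_fun setT (f i).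
Proof. exact/measurable_EFinP/(measurable_int _ (fi i)). Qed.

Let measurable_shifted v i : measurable_fun setT (shifted v i).
Proof. exact: measurable_funB. Qed.

Let integrable_shifted v : P.-integrable setT (EFin \o pwmin (shifted v)).
Proof.
have ifs : P.-integrable setT (EFin \o (fun x => f ord0 x + \sum_i `|v i|)).
  have ic : P.-integrable setT (EFin \o (fun=> \sum_i `|v i|)).
    exact: finite_measure_integrable_cst.
  by have := integrableD measurableT (fi ord0) ic; apply: eq_integrable.
apply: le_integrable ifs => //.
  by apply/measurable_EFinP; exact: measurable_pwmin.
move=> x _ /=; rewrite lee_fin [leRHS]ger0_norm ?addr_ge0 ?sumr_ge0//.
have vsum i : `|v i| <= \sum_j `|v j|.
  by rewrite (bigD1 i)//= lerDl sumr_ge0.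
rewrite ler_norml; apply/andP; split.
  apply: le_pwmin => i; rewrite /shifted.
  have := vsum i; have := f0 i x; have := f0 ord0 x; have := ler_norm (v i); lra.
apply: le_trans (pwmin_le _ ord0 x) _; rewrite /shifted lerD2l.
by apply: le_trans (vsum ord0); rewrite -normrN ler_norm.
Qed.

Let pwmin_shiftD v v' x :
  pwmin (shifted v) x <= pwmin (shifted v') x + \sum_i `|v' i - v i|.
Proof.
have [i ->] := pwmin_attained (shifted v') x.
apply: le_trans (pwmin_le _ i x) _; rewrite /shifted.
have : `|v' i - v i| <= \sum_j `|v' j - v j| by rewrite (bigD1 i)//= lerDl sumr_ge0.
by have := ler_norm (v' i - v i); lra.
Qed.

Let kantorovich_lip v v' :
  kantorovich v - kantorovich v' <= 2 * \sum_i `|v i - v' i|.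
Proof.
have ic (z : R) : P.-integrable setT (EFin \o (fun=> z)).
  exact: finite_measure_integrable_cst.
have : \int[P]_x pwmin (shifted v) x <=
    \int[P]_x pwmin (shifted v') x + \sum_i `|v i - v' i|.
  rewrite -[X in _ <= _ + X](Rintegral_cst_probability P) -RintegralD//.
  apply: le_Rintegral => //.
    by have := integrableD measurableT (integrable_shifted v') (ic (\sum_i `|v i - v' i|));
       apply: eq_integrable.
  move=> x _; apply: le_trans (pwmin_shiftD v v' x) _.
  by rewrite lerD2l ler_sum// => i _; rewrite distrC.
have : n.+1%:R^-1 * \sum_i v i - n.+1%:R^-1 * \sum_i v' i <= \sum_i `|v i - v' i|.
  rewrite -mulrBr -sumrB.
  apply: (@le_trans _ _ (n.+1%:R^-1 * \sum_i `|v i - v' i|)).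
    by rewrite ler_wpM2l ?invr_ge0// ler_sum// => i _; exact: ler_norm.
  by rewrite ler_piMl ?sumr_ge0// invf_le1 ?ltr0n// ler1n.
rewrite /kantorovich; move: (\sum_i `|_|) (_ * \sum_i v i) (_ * \sum_i v' i).
by move: (\int[P]_x pwmin (shifted v) x) (\int[P]_x pwmin (shifted v') x) => *; lra.
Qed.

Let kantorovich_shift v a : kantorovich (fun i => v i - a) = kantorovich v.
Proof.
have ic (z : R) : P.-integrable setT (EFin \o (fun=> z)).
  exact: finite_measure_integrable_cst.
have -> : kantorovich (fun i => v i - a) =
    n.+1%:R^-1 * \sum_i (v i - a) + \int[P]_x (pwmin (shifted v) x + a).
  rewrite /kantorovich; congr (_ + _); apply: eq_Rintegral => x _.
  apply/eqP; rewrite eq_le; apply/andP; split.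
    have [i ->] := pwmin_attained (shifted v) x.
    by apply: le_trans (pwmin_le _ i x) _; rewrite /shifted opprB addrA addrAC.
  apply: le_pwmin => i; rewrite /shifted opprB addrA addrAC lerD2r.
  exact: pwmin_le.
rewrite RintegralD// Rintegral_cst_probability sumrB sumr_const card_ord.
by rewrite -[a *+ _]mulr_natl mulrBr mulKf ?pnatr_eq0// addrACA addNr addr0.
Qed.

(** The functional is invariant under adding a constant to v, so the minimum of
    v can be taken to be 0.  If the maximum of v is then larger than B, the
    value is negative, hence smaller than the value at 0.  It suffices to
    maximize a continuous function on the box [0, B]^(n+1). *)
Lemma kantorovich_maximizer :
  exists v, forall v', kantorovich v' <= kantorovich v.
Proof.
pose K0 := \sum_i \int[P]_x f i x.
have If0 i : 0 <= \int[P]_x f i x by apply: Rintegral_ge0 => x _.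
have K00 : 0 <= K0 by exact: sumr_ge0.
pose B := n.+1%:R * K0.
have B0 : 0 <= B by rewrite mulr_ge0.
pose A := [set v : prod_topology (fun _ : 'I_n.+1 => R) | forall i, 0 <= v i <= B].
have cA : compact A by exact: (@compact_box R 'I_n.+1 (fun=> 0) (fun=> B)).
have A0 : A (fun=> 0) by move=> i; rewrite lexx.
have cK : continuous (kantorovich : prod_topology (fun _ : 'I_n.+1 => R) -> R).
  exact: lipschitz_coord_continuous kantorovich_lip.
have [v /[!inE] vA vmax] :=
  compact_EVT_max (ex_intro _ (fun=> 0) A0 : A !=set0) cA (continuous_subspaceT cK).
have K00v : 0 <= kantorovich v.
  apply: (@le_trans _ _ (kantorovich (fun=> 0))); last by apply: vmax; rewrite inE.
  rewrite /kantorovich big1 ?mulr0 ?add0r//.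
  by apply: Rintegral_ge0 => x _; apply: le_pwmin => i; rewrite /shifted subr0.
exists v => v'.
have [/= j _ jmin] := @arg_minP _ R _ ord0 predT v' isT.
rewrite -(kantorovich_shift v' (v' j)); set z := fun i => _.
have z0 i : 0 <= z i by rewrite subr_ge0; exact: jmin.
(* z is v' shifted so that its minimum, reached at j, is 0. *)
have [zB|] := pselect (forall i, z i <= B).
  by apply: vmax; rewrite inE => i; rewrite z0 zB.
move=> /existsNP[i0 /negP]; rewrite -ltNge => zi0.
have [/= k _ kmax] := @arg_maxP _ R _ ord0 predT z isT.
apply: le_trans K00v.
have zkB : B < z k by exact: lt_le_trans zi0 (kmax i0 isT).
have int1 : \int[P]_x pwmin (shifted z) x <= K0 - z k.
  have ic : P.-integrable setT (EFin \o (fun=> z k)).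
    exact: finite_measure_integrable_cst.
  apply: (@le_trans _ _ (\int[P]_x (f k x - z k))).
    apply: le_Rintegral => //; last by move=> x _; exact: pwmin_le.
    by have := integrableB measurableT (fi k) ic; apply: eq_integrable.
  rewrite RintegralB// Rintegral_cst_probability lerD2r.
  by rewrite /K0 (bigD1 k)//= lerDl sumr_ge0.
have zsum : \sum_i z i <= n%:R * z k.
  have jz : z j = 0 by rewrite /z subrr.
  rewrite (bigD1 j)//= jz add0r.
  apply: (@le_trans _ _ (\sum_(i | i != j) z k)).
    by apply: ler_sum => i _; exact: kmax.
  by rewrite sumr_const cardC1 card_ord /= mulr_natl.
have : n.+1%:R^-1 * \sum_i z i <= n.+1%:R^-1 * (n%:R * z k).
  by rewrite ler_wpM2l ?invr_ge0.
have -> : n.+1%:R^-1 * (n%:R * z k) = z k - n.+1%:R^-1 * z k.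
  have -> : n%:R = n.+1%:R - 1 :> R by rewrite -natr1 addrK.
  by rewrite mulrBl mul1r mulrBr mulKf ?pnatr_eq0.
have : n.+1%:R^-1 * B < n.+1%:R^-1 * z k by rewrite ltr_pM2l ?invr_gt0.
rewrite {1}/B mulKf ?pnatr_eq0// /kantorovich; move: int1; clear.
move: (_ * \sum_i z i) (\int[P]_x _) (n.+1%:R^-1 * z k) => *; lra.
Qed.

(** The condition of argmin_hall in its linear form, weakened by
    x <= exp x - 1. *)
Lemma kantorovich_maximizer_hall v : (forall v', kantorovich v' <= kantorovich v) ->
  forall (A : {set 'I_n.+1}) (t : R), 0 < t ->
    t * (#|A|%:R / n.+1%:R) <=
    \int[P]_x (expR (pwmin (shifted v) x -
      pwmin (fun i x => shifted v i x - t * (i \in A)%:R) x) - 1).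
Proof.
move=> vmax A t t0.
pose v' i := v i + t * (i \in A)%:R.
have shE : (fun i x => shifted v i x - t * (i \in A)%:R) = shifted v'.
  by apply/funext => i; apply/funext => x; rewrite /shifted /v' opprD addrA.
rewrite shE; have := vmax v'; rewrite /kantorovich /v' big_split/= -mulr_sumr.
rewrite sum_natr_mem.
move=> h.
have D : \int[P]_x (pwmin (shifted v) x - pwmin (shifted v') x) <=
    \int[P]_x (expR (pwmin (shifted v) x - pwmin (shifted v') x) - 1).
  have iD : P.-integrable setT (EFin \o (fun x => pwmin (shifted v) x - pwmin (shifted v') x)).
    by have := integrableB measurableT (integrable_shifted v) (integrable_shifted v');
       apply: eq_integrable.
  apply: le_Rintegral => //.
    pose S := \sum_i `|v' i - v i|.
    apply: (@bounded_integrable _ _ _ _ _ (expR S + 1)).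
      apply: measurable_funB => //; apply: measurableT_comp => //.
      by apply: measurable_funB; exact: measurable_pwmin.
    move=> x; apply: le_trans (ler_normB _ _) _.
    rewrite normr1 lerD2r ger0_norm ?expR_ge0// ler_expR.
    by rewrite lerBlDl; exact: pwmin_shiftD.
  by move=> x _; rewrite lerBrDl; exact: expR_ge1Dx.
apply: le_trans D; rewrite RintegralB//.
rewrite [_ / _]mulrC mulrCA; move: h; rewrite mulrDr.
move: (_ * (t * _)) (_ * \sum_i v i) (\int[P]_x pwmin (shifted v) x).
by move: (\int[P]_x _) => *; lra.
Qed.

End semidiscrete.

(** * First-order conditions at a dual optimum *)

Section dual_optimality.
Context {R : realType} {d} {T : measurableType d} {n : nat}.
Variables (Q : probability T R) (f : 'I_n.+1 -> T -> R) (rs : R).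
Hypotheses (mf : forall i, measurable_fun setT (f i))
  (f0 : forall i x, 0 <= f i x).
Implicit Types (lam : R) (u : 'I_n.+1 -> R).

Local Notation C lam u := (pwmin (reduced_cost f lam u)).

Definition log_partition lam u : R := ln (\int[Q]_x expR (- C lam u x)).

(** The dual objective is linear_part - log_partition. *)
Definition linear_part lam u : R := n.+1%:R^-1 * \sum_i u i - lam * rs.

Let mC lam u : measurable_fun setT (C lam u).
Proof. by apply: measurable_pwmin => i; exact: measurable_reduced_cost. Qed.

Let C_ge lam u : 0 <= lam -> forall x, - (\sum_i `|u i|) <= C lam u x.
Proof.
move=> lam0 x; apply: le_pwmin => i; rewrite /reduced_cost.
have : `|u i| <= \sum_j `|u j| by rewrite (bigD1 i)//= lerDl sumr_ge0.
have := ler_norm (u i); have : 0 <= lam * f i x by rewrite mulr_ge0.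
by move: (\sum_j _) => *; lra.
Qed.

Let mexpC lam u : measurable_fun setT (fun x => expR (- C lam u x)).
Proof. by apply: measurableT_comp => //; exact: measurable_funN. Qed.

Lemma partition_integrable lam u : 0 <= lam ->
  Q.-integrable setT (EFin \o (fun x => expR (- C lam u x))).
Proof.
move=> lam0; apply: (@bounded_integrable _ _ _ _ _ (expR (\sum_i `|u i|))) => // x.
by rewrite ger0_norm ?expR_ge0// ler_expR lerNl; exact: C_ge.
Qed.

Lemma partition_gt0 lam u : 0 <= lam -> 0 < \int[Q]_x expR (- C lam u x).
Proof.
move=> lam0; rewrite lt_def Rintegral_ge0 ?andbT; last by move=> x _; exact: expR_ge0.
apply/eqP => I0.
have I0' : (\int[Q]_x (expR (- C lam u x))%:E = 0)%E.
  rewrite -[LHS]fineK; first by have := I0; rewrite /Rintegral => ->.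
  by apply: integrable_fin_num => //; exact: partition_integrable.
have : ae_eq Q setT (EFin \o (fun x => expR (- C lam u x))) (cst 0%E).
  apply/ae_eq_integral_abs => //; first exact/measurable_EFinP.
  rewrite -[RHS]I0'; apply: eq_integral => x _ /=.
  by rewrite ger0_norm// expR_ge0.
move=> [N [mN N0 sub]].
have NT : N = setT.
  apply/seteqP; split=> // x _; apply: sub => /= /(_ Logic.I) [/eqP].
  by rewrite expR_eq0.
move: N0; rewrite NT => e; have := probability_setT Q; rewrite e => /eqP.
by rewrite eq_sym onee_eq0.
Qed.

Variables (lam : R) (u : 'I_n.+1 -> R).
Hypothesis lam0 : 0 <= lam.

(** The logarithm of the density of the Gibbs measure G. *)
Definition gibbs_exponent x := - C lam u x - log_partition lam u.

Lemma measurable_gibbs_exponent : measurable_fun setT gibbs_exponent.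
Proof. by apply: measurable_funB => //; exact: measurable_funN. Qed.

Lemma gibbs_densityE x :
  expR (gibbs_exponent x) = expR (- C lam u x) / \int[Q]_x expR (- C lam u x).
Proof. by rewrite /gibbs_exponent /log_partition expRB lnK// posrE partition_gt0. Qed.

Lemma gibbs_mass : (\int[Q]_x (expR (gibbs_exponent x))%:E = 1)%E.
Proof.
have i0 := partition_gt0 u lam0.
transitivity ((\int[Q]_x (expR (- C lam u x) / \int[Q]_x expR (- C lam u x))) %:E)%E.
  rewrite fineK; last first.
    apply: integrable_fin_num => //.
    have := integrableZr measurableT (\int[Q]_x expR (- C lam u x))^-1
      (partition_integrable u lam0).
    by apply: eq_integrable.
  by apply: eq_integral => x _; rewrite gibbs_densityE.
rewrite RintegralZr//; last exact: partition_integrable.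
by rewrite mulfV ?gt_eqF.
Qed.

Variable G : probability T R.
Hypothesis QG : has_density Q G (expR \o gibbs_exponent).

Hypothesis optimal : forall lam' u', 0 <= lam' ->
  linear_part lam' u' - log_partition lam' u' <=
  linear_part lam u - log_partition lam u.

(** Exponential tilting: the G-integral of exp(C - C') is the ratio of the
    partition functions. *)
Lemma gibbs_exp_integrable lam' u' : 0 <= lam' ->
  G.-integrable setT (EFin \o (fun x => expR (C lam u x - C lam' u' x))) /\
  \int[G]_x expR (C lam u x - C lam' u' x) =
    expR (log_partition lam' u' - log_partition lam u).
Proof.
move=> lam'0.
have mD : measurable_fun setT (fun x => expR (C lam u x - C lam' u' x)).
  by apply: measurableT_comp => //; exact: measurable_funB.
have e x : expR (C lam u x - C lam' u' x) * (expR \o gibbs_exponent) x =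
    expR (- log_partition lam u) * expR (- C lam' u' x).
  by rewrite /= -!expRD; congr expR; rewrite /gibbs_exponent; lra.
have iZ := integrableZl measurableT (expR (- log_partition lam u)) (partition_integrable u' lam'0).
have iG : G.-integrable setT (EFin \o (fun x => expR (C lam u x - C lam' u' x))).
  apply/(integrable_density QG mD).
  by apply: eq_integrable iZ => // x _; rewrite /= e EFinM.
split=> //; rewrite (Rintegral_density QG mD iG).
under eq_Rintegral do rewrite e.
rewrite RintegralZl//; last exact: partition_integrable.
rewrite [in RHS]addrC [in RHS]expRD {2}/log_partition lnK//.
by rewrite posrE partition_gt0.
Qed.

(** Optimality bounds the increment of the linear part by that of the
    log-partition function, and log x <= x - 1 turns the latter into an
    integral against the fixed measure G. *)
Lemma optimal_increment lam' u' : 0 <= lam' ->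
  linear_part lam' u' - linear_part lam u <=
  \int[G]_x (expR (C lam u x - C lam' u' x) - 1).
Proof.
move=> lam'0; have [i e] := gibbs_exp_integrable u' lam'0.
have ic : G.-integrable setT (EFin \o (fun=> 1 : R)).
  exact: finite_measure_integrable_cst.
rewrite RintegralB// e Rintegral_cst_probability.
have := expR_ge1Dx (log_partition lam' u' - log_partition lam u).
have := optimal u' lam'0.
by move: (log_partition _ _) (log_partition _ _) (linear_part _ _) (linear_part _ _) => *; lra.
Qed.

(** The previous inequality in the direction of the indicator of A: the premise
    of argmin_hall. *)
Lemma optimal_hall (A : {set 'I_n.+1}) (t : R) : 0 < t ->
  t * (#|A|%:R / n.+1%:R) <=
  \int[G]_x (expR (C lam u x -
    pwmin (fun i x => reduced_cost f lam u i x - t * (i \in A)%:R) x) - 1).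
Proof.
move=> t0.
pose u' i := u i + t * (i \in A)%:R.
have shE : (fun i x => reduced_cost f lam u i x - t * (i \in A)%:R) = reduced_cost f lam u'.
  by apply/funext => i; apply/funext => x; rewrite /reduced_cost /u' opprD addrA.
rewrite shE; apply: le_trans (optimal_increment u' lam0).
rewrite /linear_part /u' big_split/= -mulr_sumr.
rewrite sum_natr_mem.
rewrite mulrDr [_ / _]mulrC mulrCA.
move: (_ * (t * _)) (_ * \sum_i u i) => a b; lra.
Qed.

End dual_optimality.

(** For x bounded below, exp(-x) beats x^2 exp(|x|/2): this bounds the
    second-order remainder under the Gibbs measure.  The constant 16 comes from
    x/4 <= exp(x/4). *)
Lemma sqr_expR_half_bound {R : realType} (x m : R) : 0 <= m -> - m <= x ->
  x ^+ 2 * expR (`|x| / 2) * expR (- x) <= 16 + m ^+ 2 * expR (2 * m).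
Proof.
move=> m0 mx; rewrite -mulrA -expRD.
have [x0|x0] := leP 0 x.
  rewrite ger0_norm// (_ : x / 2 - x = - (x / 2)); last by lra.
  apply: (@le_trans _ _ 16); last by rewrite lerDl mulr_ge0 ?sqr_ge0 ?expR_ge0.
  rewrite expRN ler_pdivrMr ?expR_gt0//.
  have -> : expR (x / 2) = expR (x / 4) ^+ 2 by rewrite -expRM_natl; congr expR; lra.
  have h : x / 4 <= expR (x / 4) by apply: le_trans (expR_ge1Dx _); lra.
  have : (x / 4) ^+ 2 <= expR (x / 4) ^+ 2.
    by rewrite ler_pXn2r// nnegrE ?expR_ge0// divr_ge0.
  by rewrite expr_div_n => /(ler_wpM2l (ler0n _ 16)); lra.
apply: (@le_trans _ _ (m ^+ 2 * expR (2 * m))); last by rewrite lerDr.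
rewrite ltr0_norm//; apply: ler_pM; rewrite ?sqr_ge0 ?expR_ge0//.
  by rewrite -ler_sqrt ?sqr_ge0// !sqrtr_sqr ltr0_norm// ger0_norm// lerNl.
by rewrite ler_expR; lra.
Qed.

Lemma pwminM {R : realType} {T : Type} {n : nat} (k : R) (phi : 'I_n.+1 -> T -> R) x :
  0 <= k -> pwmin (fun i x => k * phi i x) x = k * pwmin phi x.
Proof.
move=> k0; apply/eqP; rewrite eq_le; apply/andP; split.
  have [i ->] := pwmin_attained phi x.
  exact: (pwmin_le (fun i x => k * phi i x)).
by apply: le_pwmin => i; rewrite ler_wpM2l// pwmin_le.
Qed.

Lemma pwminD {R : realType} {T : Type} {n : nat} (a : R) (phi : 'I_n.+1 -> T -> R) x :
  pwmin (fun i x => phi i x + a) x = pwmin phi x + a.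
Proof.
apply/eqP; rewrite eq_le; apply/andP; split.
  have [i ->] := pwmin_attained phi x.
  exact: (pwmin_le (fun i x => phi i x + a)).
by apply: le_pwmin => i; rewrite lerD2r pwmin_le.
Qed.

(** A linear function below a parabola on both sides of 0 has slope 0. *)
Lemma slope_eq0 {R : realType} (b K : R) :
  (forall t, `|t| <= 2^-1 -> b * t <= t ^+ 2 * K) -> b = 0.
Proof.
move=> h; apply/eqP; apply: contraT => b0.
pose K1 := Num.max K 1 + `|b|.
have nb : 0 < `|b| by rewrite normr_gt0.
have K10 : 0 < K1 by rewrite addr_gt0// lt_max ltr01 orbT.
have KK1 : K <= K1 by rewrite (@le_trans _ _ (Num.max K 1)) ?le_max ?lexx// lerDl.
pose t := b / (2 * K1).
have tn : `|t| = `|b| / (2 * K1).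
  by rewrite normrM normfV [`|2 * K1|]gtr0_norm ?mulr_gt0.
have t2 : `|t| <= 2^-1.
  rewrite tn ler_pdivrMr ?mulr_gt0// mulKf ?pnatr_eq0//.
  by rewrite lerDr le_max ler01 orbT.
have := h t t2.
have tE : t * (2 * K1) = b by rewrite divfK// mulf_neq0 ?gt_eqF.
have : t ^+ 2 * K <= t ^+ 2 * K1 by rewrite ler_wpM2l ?sqr_ge0.
have : 0 < t ^+ 2 * K1.
  rewrite mulr_gt0// exprn_even_gt0//=; apply: contra b0 => /eqP t0.
  by rewrite -tE t0 mul0r.
by rewrite -{1}tE expr2; lra.
Qed.

(** * Feasible plans for the Gibbs measure *)

Section argmin_plan.
Context {R : realType} {d} {T : measurableType d} {n : nat}.
Variables (P : probability T R) (f : 'I_n.+1 -> T -> R) (k : R) (v : 'I_n.+1 -> R)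
  (pi : 'I_n.+1 -> T -> R).
Hypotheses (k0 : 0 < k) (mpi : forall i, measurable_fun setT (pi i))
  (pi01 : forall i x, 0 <= pi i x <= 1) (pi1 : forall x, \sum_i pi i x = 1)
  (piE : forall i, \int[P]_x pi i x = n.+1%:R^-1)
  (iC : P.-integrable setT (EFin \o pwmin (reduced_cost f k v)))
  (pi_argmin : forall i x, pi i x != 0 ->
     reduced_cost f k v i x = pwmin (reduced_cost f k v) x).

(** Where pi i x is nonzero, k f_i = C + v_i; average over i, then over P. *)
Lemma argmin_plan_cost :
  P.-integrable setT (EFin \o (fun x => \sum_i f i x * pi i x)) /\
  \int[P]_x (\sum_i f i x * pi i x) =
    k^-1 * (\int[P]_x pwmin (reduced_cost f k v) x + n.+1%:R^-1 * \sum_i v i).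
Proof.
set C := pwmin _.
have e x : \sum_i f i x * pi i x = k^-1 * (C x + \sum_i v i * pi i x).
  rewrite -[C x]mulr1 -(pi1 x) mulr_sumr -big_split/= mulr_sumr.
  apply: eq_bigr => i _; rewrite -mulrDl mulrA.
  have [->|p0] := eqVneq (pi i x) 0; first by rewrite !mulr0.
  by rewrite /C -(pi_argmin p0) /reduced_cost subrK mulKf ?gt_eqF.
have ipi i : P.-integrable setT (EFin \o (fun x => v i * pi i x)).
  apply: (@bounded_integrable _ _ _ _ _ `|v i|); first exact: measurable_funM.
  move=> x; have /andP[h0 h1] := pi01 i x.
  by rewrite normrM (ger0_norm h0) ler_piMr.
have iS : P.-integrable setT (EFin \o (fun x => \sum_i v i * pi i x)).
  have := @integrable_sum _ _ _ P setT measurableT _ (index_enum 'I_n.+1) predT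
    (fun i => EFin \o (fun x => v i * pi i x)).
  move=> /(_ (fun i _ => ipi i)); apply: eq_integrable => // x _ /=.
  by rewrite sumEFin.
have iCS : P.-integrable setT (EFin \o (fun x => C x + \sum_i v i * pi i x)).
  by have := integrableD measurableT iC iS; apply: eq_integrable.
have ikCS : P.-integrable setT (EFin \o (fun x => k^-1 * (C x + \sum_i v i * pi i x))).
  by have := integrableZl measurableT k^-1 iCS; apply: eq_integrable.
split.
  by apply: eq_integrable ikCS => // x _ /=; rewrite e.
under eq_Rintegral do rewrite e.
rewrite RintegralZl// RintegralD// Rintegral_sum//; congr (_ * (_ + _)).
rewrite mulr_sumr; apply: eq_bigr => i _; rewrite RintegralZl//; first by rewrite piE mulrC.
apply: (@bounded_integrable _ _ _ _ _ 1) => // x.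
by have /andP[h0 h1] := pi01 i x; rewrite ger0_norm.
Qed.

End argmin_plan.

Section gibbs_plan.
Context {R : realType} {d} {T : measurableType d} {n : nat}.
Variables (Q : probability T R) (f : 'I_n.+1 -> T -> R) (rs : R).
Hypotheses (mf : forall i, measurable_fun setT (f i))
  (f0 : forall i x, 0 <= f i x).
Variables (lam : R) (u : 'I_n.+1 -> R) (G : probability T R).
Hypotheses (lam0 : 0 <= lam)
  (QG : has_density Q G (expR \o gibbs_exponent Q f lam u))
  (optimal : forall lam' u', 0 <= lam' ->
    linear_part rs lam' u' - log_partition Q f lam' u' <=
    linear_part rs lam u - log_partition Q f lam u).

Local Notation C lam u := (pwmin (reduced_cost f lam u)).

Let mC l v : measurable_fun setT (C l v).
Proof. by apply: measurable_pwmin => i; exact: measurable_reduced_cost. Qed.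

Let increment := optimal_increment mf f0 QG optimal.

(** Stationarity along the ray through (lam, u).  Scaling the dual point by
    1 + t scales both C and the linear part, so t a <= int (exp(-tC) - 1) dG
    <= - t int C dG + O(t^2) for small t of either sign.  Even
    when lam = 0 the ray extends on both sides inside the domain of the dual
    problem. *)
Lemma gibbs_mean :
  G.-integrable setT (EFin \o C lam u) /\
  \int[G]_x C lam u x = - linear_part rs lam u.
Proof.
pose g x := C lam u x ^+ 2 * expR (`|C lam u x| / 2).
have g0 x : 0 <= g x by rewrite mulr_ge0 ?sqr_ge0 ?expR_ge0.
have mg : measurable_fun setT g.
  apply: measurable_funM; first exact: measurable_funX.
  apply: measurableT_comp => //; apply: measurable_funM => //.
  exact: measurableT_comp.
pose m := \sum_i `|u i|.
have m0 : 0 <= m by exact: sumr_ge0.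
have mCx x : - m <= C lam u x.
  apply: le_pwmin => i; rewrite /reduced_cost.
  have : `|u i| <= m by rewrite /m (bigD1 i)//= lerDl sumr_ge0.
  have := ler_norm (u i); have : 0 <= lam * f i x by rewrite mulr_ge0.
  by move: m {m0} => m; lra.
have ig : G.-integrable setT (EFin \o g).
  apply/(integrable_density QG mg).
  apply: (@bounded_integrable _ _ _ _ _
     ((16 + m ^+ 2 * expR (2 * m)) * expR (- log_partition Q f lam u))).
    by apply: measurable_funM => //; have [] := QG.
  move=> x; rewrite ger0_norm /=; last exact: mulr_ge0 (g0 x) (expR_ge0 _).
  rewrite /gibbs_exponent expRD mulrA ler_wpM2r ?expR_ge0//.
  exact: sqr_expR_half_bound.
have iCC : G.-integrable setT (EFin \o C lam u).
  have i1 : G.-integrable setT (EFin \o (fun=> 1 : R)).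
    exact: finite_measure_integrable_cst.
  have i1g : G.-integrable setT (EFin \o (fun x => 1 + g x)).
    by have := integrableD measurableT i1 ig; apply: eq_integrable.
  apply: le_integrable i1g => //; first exact/measurable_EFinP.
  move=> x _ /=; rewrite lee_fin [leRHS]ger0_norm ?addr_ge0//.
  apply: (@le_trans _ _ (1 + C lam u x ^+ 2)).
    rewrite -[C lam u x ^+ 2]real_normK ?num_real//.
    by have := sqr_ge0 (`|C lam u x| - 2^-1); rewrite !expr2; lra.
  rewrite lerD2l /g ler_peMr ?sqr_ge0// -expR0 ler_expR.
  by rewrite divr_ge0.
split=> //.
set a := linear_part rs lam u; set E := \int[G]_x _.
suff : a + E = 0 by move/eqP; rewrite addr_eq0 => /eqP ->; rewrite opprK.
apply: (@slope_eq0 _ _ (\int[G]_x g x)) => t t2.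
have t1 : 0 <= 1 + t.
  by have := ler_norm (- t); rewrite normrN; move: t2 => {iCC ig} t2 ?; lra.
have CE x : C ((1 + t) * lam) (fun i => (1 + t) * u i) x = (1 + t) * C lam u x.
  rewrite -pwminM//; apply: eq_pwmin => i.
  by rewrite /reduced_cost mulrBr mulrA.
have := increment (fun i => (1 + t) * u i) (mulr_ge0 t1 lam0).
have -> : linear_part rs ((1 + t) * lam) (fun i => (1 + t) * u i) - linear_part rs lam u = t * a.
  by rewrite /a /linear_part -mulr_sumr; ring.
have itC : G.-integrable setT (EFin \o (fun x => - t * C lam u x)).
  by have := integrableZl measurableT (- t) iCC; apply: eq_integrable.
have itg : G.-integrable setT (EFin \o (fun x => t ^+ 2 * g x)).
  by have := integrableZl measurableT (t ^+ 2) ig; apply: eq_integrable.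
have itCg : G.-integrable setT (EFin \o (fun x => - t * C lam u x + t ^+ 2 * g x)).
  by have := integrableD measurableT itC itg; apply: eq_integrable.
have ptw x : expR (C lam u x - C ((1 + t) * lam) (fun i => (1 + t) * u i) x) - 1 <=
    - t * C lam u x + t ^+ 2 * g x.
  rewrite CE (_ : C lam u x - (1 + t) * C lam u x = - t * C lam u x); last by ring.
  apply: le_trans (expR_sub1_le_quad _) _.
  rewrite lerD2l exprMn sqrrN -mulrA.
  apply: ler_wpM2l (sqr_ge0 _) _ _ _; apply: ler_wpM2l (sqr_ge0 _) _ _ _.
  by rewrite ler_expR normrM normrN mulrC ler_wpM2l.
have [ie _] := gibbs_exp_integrable mf f0 QG (fun i => (1 + t) * u i) (mulr_ge0 t1 lam0).
have : \int[G]_x (expR (C lam u x - C ((1 + t) * lam) (fun i => (1 + t) * u i) x) - 1) <=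
    \int[G]_x (- t * C lam u x + t ^+ 2 * g x).
  apply: le_Rintegral => //.
  have i1 : G.-integrable setT (EFin \o (fun=> 1 : R)).
    exact: finite_measure_integrable_cst.
  by have := integrableB measurableT ie i1; apply: eq_integrable.
have -> : \int[G]_x (- t * C lam u x + t ^+ 2 * g x) = - t * E + t ^+ 2 * \int[G]_x g x.
  by rewrite RintegralD// !RintegralZl.
move=> h1 h2; have {h1 h2} := le_trans h2 h1.
by move: (\int[G]_x g x) => z; lra.
Qed.

(** For lam = 0 the function C is constant, equal to minus the linear part of
    the optimum by gibbs_mean.  Compare with the dual point whose function is
    l C_{1,v} plus this constant. *)
Lemma zero_multiplier_laplace v l : lam = 0 -> 0 < l ->
  1 - l * (rs - n.+1%:R^-1 * \sum_i v i) <= \int[G]_x expR (- (l * C 1 v x)).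
Proof.
move=> l0 lpos; have [iC EC] := gibbs_mean.
pose c0 := - linear_part rs lam u.
have Cc x : C lam u x = c0.
  rewrite /c0 -EC -[LHS](Rintegral_cst_probability G); apply: eq_Rintegral => y _.
  by apply/eqP; rewrite eq_le; apply/andP; split; apply: le_pwmin => i;
     apply: le_trans (pwmin_le _ i _) _; rewrite /reduced_cost l0 !mul0r.
pose u' i := l * v i - c0.
have CE x : C l u' x = l * C 1 v x + c0.
  rewrite -pwminM ?(ltW lpos)// -pwminD; apply: eq_pwmin => i.
  by rewrite /reduced_cost /u' mul1r; lra.
have := increment u' (ltW lpos).
have -> : linear_part rs l u' - linear_part rs lam u =
    - (l * (rs - n.+1%:R^-1 * \sum_i v i)).
  rewrite -[in X in _ - X = _](opprK (linear_part rs lam u)) -/c0.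
  rewrite /linear_part /u' sumrB -mulr_sumr sumr_const card_ord.
  rewrite -[c0 *+ _]mulr_natl mulrBr mulKf ?pnatr_eq0//.
  by ring.
have [ie _] := gibbs_exp_integrable mf f0 QG u' (ltW lpos).
rewrite RintegralB//; last exact: finite_measure_integrable_cst.
rewrite Rintegral_cst_probability.
have -> : \int[G]_x expR (C lam u x - C l u' x) = \int[G]_x expR (- (l * C 1 v x)).
  by apply: eq_Rintegral => x _; rewrite Cc CE; congr expR; lra.
by rewrite lerBrDr addrC.
Qed.

(** The costs of two atoms dominate each other up to constants.  When lam = 0,
    the bound on the least cost thus makes every f_i integrable, as the
    Kantorovich problem requires.  The kernel then comes from a maximizer v
    instead of from u. *)
Lemma gibbs_plan (D : R) : (forall i j x, f i x <= D * (f j x + 1)) ->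
  exists pi : 'I_n.+1 -> T -> R,
    [/\ [/\ forall i, measurable_fun setT (pi i), forall i x, 0 <= pi i x <= 1,
            forall x, \sum_i pi i x = 1 &
            forall i, \int[G]_x pi i x = n.+1%:R^-1],
        G.-integrable setT (EFin \o (fun x => \sum_i f i x * pi i x)) &
        \int[G]_x (\sum_i f i x * pi i x) <= rs].
Proof.
move=> fD; have [iC EC] := gibbs_mean.
have [lpos|] := ltP 0 lam.
  have hall := argmin_hall (fun i => measurable_reduced_cost lam u (mf i))
    (fun A t => optimal_hall mf f0 lam0 QG optimal A (t := t)).
  have [pi [mpi pi01 pi1 piE pia]] := argmin_kernel
    (fun i => measurable_reduced_cost lam u (mf i)) hall.
  have [i e] := argmin_plan_cost lpos mpi pi01 pi1 piE iC pia.
  exists pi; split=> //; rewrite e EC /linear_part.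
  rewrite opprB subrK mulKf ?gt_eqF//.
move=> l0; have {l0} l0 : lam = 0 by apply/eqP; rewrite eq_le l0 lam0.
have C1_bound v : G.-integrable setT (EFin \o C 1 v) /\
    \int[G]_x C 1 v x <= rs - n.+1%:R^-1 * \sum_i v i.
  apply: (@integral_le_of_laplace _ _ _ _ _ (\sum_i `|v i|)) => //.
    move=> x; apply: le_pwmin => i; rewrite /reduced_cost mul1r.
    have : `|v i| <= \sum_j `|v j| by rewrite (bigD1 i)//= lerDl sumr_ge0.
    have := ler_norm (v i); have := f0 i x.
    by move: (\sum_j _) => *; lra.
  by move=> l lpos; exact: zero_multiplier_laplace.
have fi i : G.-integrable setT (EFin \o f i).
  have [im _] := C1_bound (fun=> 0).
  have i1 : G.-integrable setT (EFin \o (fun=> 1 : R)).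
    exact: finite_measure_integrable_cst.
  have im1 : G.-integrable setT (EFin \o (fun x => C 1 (fun=> 0) x + 1)).
    by have := integrableD measurableT im i1; apply: eq_integrable.
  have iD : G.-integrable setT (EFin \o (fun x => D * (C 1 (fun=> 0) x + 1))).
    by have := integrableZl measurableT D im1; apply: eq_integrable.
  apply: le_integrable iD => //; first exact/measurable_EFinP.
  move=> x _ /=; rewrite lee_fin ger0_norm//; apply: le_trans (ler_norm _).
  have [j ->] := pwmin_attained (reduced_cost f 1 (fun=> 0)) x.
  by rewrite /reduced_cost mul1r subr0.
have shE v : (fun i x => f i x - v i) = reduced_cost f 1 v.
  by apply/funext => i; apply/funext => x; rewrite /reduced_cost mul1r.
have [v vmax] := kantorovich_maximizer fi f0.
have hall0 := kantorovich_maximizer_hall fi f0 vmax.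
have hall := @argmin_hall _ _ _ _ G (reduced_cost f 1 v)
  (fun i => measurable_reduced_cost 1 v (mf i)).
have [||pi [mpi pi01 pi1 piE pia]] := @argmin_kernel _ _ _ _ G (reduced_cost f 1 v).
- by move=> i; exact: measurable_reduced_cost.
- apply: hall => A t t0; have := hall0 A t t0; rewrite -shE; exact.
have [iv Ev] := C1_bound v.
have [i e] := argmin_plan_cost ltr01 mpi pi01 pi1 piE iv pia.
by exists pi; split=> //; rewrite e invr1 mul1r -lerBrDr.
Qed.

End gibbs_plan.

(** * The least favorable distribution *)

Lemma has_density_trans {R : realType} {d} {T : measurableType d}
    (mu : {sigma_finite_measure set T -> \bar R}) (nu : {finite_measure set T -> \bar R})
    (P : set T -> \bar R) (f g : T -> R) :
  has_density mu nu f -> has_density nu P g ->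
  has_density mu P (fun x => g x * f x).
Proof.
move=> muf nug; have [mf f0 fE] := muf; have [mg g0 gE] := nug.
split=> [|x|A mA]; [exact: measurable_funM|exact: mulr_ge0|].
rewrite gE// integral_mkcond [RHS]integral_mkcond.
rewrite (eq_integral (fun x => (\1_A x * g x)%:E)); last first.
  by move=> x _; rewrite patchE indicE; case: ifP; rewrite ?mul1r ?mul0r.
rewrite (ge0_integral_density muf); last 2 first.
- by apply: measurable_funM.
- by move=> x; rewrite mulr_ge0.
apply: eq_integral => x _; rewrite patchE indicE.
by case: ifP; rewrite ?mul1r ?mul0r.
Qed.

Lemma powRD_le {R : realType} (a b s : R) : 0 <= a -> 0 <= b -> 0 <= s ->
  (a + b) `^ s <= 2 `^ s * (a `^ s + b `^ s).
Proof.
move=> a0 b0 s0; pose m := Num.max a b.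
have m0 : 0 <= m by rewrite le_max a0.
apply: (@le_trans _ _ ((2 * m) `^ s)).
  apply: ge0_ler_powR; rewrite ?nnegrE ?addr_ge0 ?mulr_ge0//.
  have : a <= m by rewrite le_max lexx.
  have : b <= m by rewrite le_max lexx orbT.
  lra.
rewrite powRM// ler_wpM2l ?powR_ge0// /m /Num.max.
by case: ifP => _; rewrite ?lerDl ?lerDr powR_ge0.
Qed.

Section assembly.
Context {R : realType} {d n : nat}.
Local Notation T := (euclid R d).
Variables (X : set T) (c : T -> T -> R) (Q : probability T R) (q : T -> R)
  (w : 'I_n.+1 -> T) (s r : R).
Hypotheses (mX : measurable X) (c_metric : metric_on X c)
  (mc : measurable_fun (X `*` X) (fun z => c z.1 z.2))
  (QX : concentrated_on X Q) (q_pdf : is_pdf X Q q)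
  (wX : forall i, X (w i)) (s_ge1 : 1 <= s) (r_ge0 : 0 <= r).

Let f := cost_to X c s w.

Let mf i : measurable_fun setT (f i). Proof. exact: measurable_cost_to. Qed.

Let f0 i x : 0 <= f i x. Proof. exact: costX_ge0. Qed.

Let s0 : 0 <= s. Proof. exact: le_trans s_ge1. Qed.

Lemma CcostE lam u x : X x ->
  Ccost c s w lam u x = pwmin (reduced_cost f lam u) x.
Proof.
move=> Xx.
have e i : lam * c x (w i) `^ s - u i = reduced_cost f lam u i x.
  by rewrite /reduced_cost /f /cost_to costXE.
by rewrite /Ccost /pwmin e; apply: eq_bigr => i _.
Qed.

Lemma has_density_restrict : has_density (lebesgue d) Q (fun x => if x \in X then q x else 0).
Proof.
have [mq q0 qE] := q_pdf; split=> [|x|A mA].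
- exact: (measurable_restrictT _ mX).1 mq.
- by case: ifPn => //; rewrite inE; exact: q0.
rewrite qE// integral_mkcondr; apply: eq_integral => x _.
by rewrite patchE; case: ifP.
Qed.

Lemma etaE lam u : 0 <= lam ->
  eta X c s w q lam u = \int[Q]_x expR (- pwmin (reduced_cost f lam u) x).
Proof.
move=> lam0.
rewrite (Rintegral_density has_density_restrict); last 2 first.
- apply: measurableT_comp => //; apply: measurable_funN.
  by apply: measurable_pwmin => i; exact: measurable_reduced_cost.
- exact: partition_integrable.
rewrite /eta /Rintegral integral_mkcond; congr fine; apply: eq_integral => x _.
rewrite patchE; case: ifPn => [|_]; last by rewrite mulr0.
by rewrite inE => Xx; rewrite CcostE// mulrC.
Qed.

Lemma dualE lam u : 0 <= lam ->
  dual X c s r w q lam u = linear_part (r `^ s) lam u - log_partition Q f lam u.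
Proof.
move=> lam0; rewrite /dual etaE// /linear_part /log_partition mulNr.
by rewrite [- _ + _]addrC.
Qed.

Lemma cost_to_triangle x y i : X x -> X y ->
  c x y `^ s <= 2 `^ s * (f i x + c (w i) y `^ s).
Proof.
move=> Xx Xy; have [c0 _ _ ctri] := c_metric.
rewrite /f /cost_to costXE//.
apply: le_trans (powRD_le (c0 _ _ Xx (wX i)) (c0 _ _ (wX i) Xy) s0).
by apply: ge0_ler_powR; rewrite ?nnegrE ?addr_ge0 ?c0// ctri.
Qed.

Lemma cost_to_comparable i j x :
  f i x <= 2 `^ s * (1 + \sum_k \sum_l c (w k) (w l) `^ s) * (f j x + 1).
Proof.
set S := \sum_k _.
have S0 : 0 <= S by apply: sumr_ge0 => k _; apply: sumr_ge0 => l _; exact: powR_ge0.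
have cS : c (w j) (w i) `^ s <= S.
  rewrite /S (bigD1 j)//= (bigD1 i)//= -addrA lerDl addr_ge0// sumr_ge0// => k _.
    exact: powR_ge0.
  by apply: sumr_ge0 => l _; exact: powR_ge0.
have p0 : 0 <= 2 `^ s :> R by exact: powR_ge0.
rewrite -mulrA.
have [Xx|nXx] := pselect (X x).
  rewrite {1}/f /cost_to costXE//.
  apply: le_trans (cost_to_triangle j Xx (wX i)) _; rewrite ler_wpM2l//.
  have := f0 j x; move: cS S0; move: (f j x) => z h1 h2 h3.
  have : 0 <= S * z by rewrite mulr_ge0.
  by move: h1 h2; move: (S) => S'; lra.
rewrite {1}/f /cost_to /costX memNset; last by move=> [].
by rewrite !mulr_ge0// addr_ge0.
Qed.

Section optimum.
Variables (lam : R) (u : 'I_n.+1 -> R).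
Hypothesis opt : dual_optimizer X c s r w q lam u.

Let lam0 : 0 <= lam. Proof. by case: opt. Qed.

Let optimal lam' u' : 0 <= lam' ->
  linear_part (r `^ s) lam' u' - log_partition Q f lam' u' <=
  linear_part (r `^ s) lam u - log_partition Q f lam u.
Proof. move=> l0; have [_ h] := opt.
exact: eq_ind _ (fun z => z <= _) (eq_ind _ (fun z => _ <= z) (h lam' u' l0) _
  (dualE u lam0)) _ (dualE u' l0). Qed.

Variable G : probability T R.
Hypothesis QG : has_density Q G (expR \o gibbs_exponent Q f lam u).

Lemma gibbs_concentrated : concentrated_on X G.
Proof.
have QXC : Q (~` X) = 0%E by rewrite probability_setC// QX subee.
have GXC := (null_content_dominatesP _ _).1 (has_density_dominates QG)
  _ (measurableC mX) QXC.
have fG : G X \is a fin_num by exact: fin_num_measure.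
have : (1 - G X = 0)%E := etrans (esym (probability_setC G mX)) GXC.
rewrite -(fineK fG) -EFinB => -[/eqP]; rewrite subr_eq0 => /eqP e.
by apply: etrans (esym (fineK fG)) _; rewrite -e.
Qed.

(** The plan of gibbs_plan gives the Wasserstein bound.  It also gives the
    moments around any x0, as c^s(x,x0) is at most 2^s times the average over
    the plan of c^s(x,w_i), plus a constant. *)
Lemma gibbs_feasible : feasible X c s r w G.
Proof.
have [pi [[mpi pi01 pi1 piE] ifp fp]] := gibbs_plan mf f0 lam0 QG optimal cost_to_comparable.
split; last first.
  have [Gam [cGam GamE]] := coupling_of_kernel w mpi pi01 pi1 piE.
  apply: (wasserstein_le s_ge1 r_ge0 cGam).
  rewrite GamE; [|exact: measurable_costX|exact: costX_ge0].
  rewrite -ge0_integral_sum//; last 2 first.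
  - by move=> i; apply/measurable_EFinP; apply: measurable_funM => //; exact: mf.
  - by move=> i x _; rewrite lee_fin mulr_ge0// ?costX_ge0//; have /andP[] := pi01 i x.
  under eq_integral do rewrite sumEFin.
  rewrite -lee_fin fineK in fp; last exact: integrable_fin_num ifp.
  exact: fp.
split; first exact: gibbs_concentrated.
move=> x0 Xx0.
pose k := \sum_i c (w i) x0 `^ s.
have ik : G.-integrable setT (EFin \o (fun=> k)).
  exact: finite_measure_integrable_cst.
have ifk : G.-integrable setT (EFin \o (fun x => \sum_i f i x * pi i x + k)).
  by have := integrableD measurableT ifp ik; apply: eq_integrable.
have iB : G.-integrable setT
    (EFin \o (fun x => 2 `^ s * (\sum_i f i x * pi i x + k))).
  by have := integrableZl measurableT (2 `^ s) ifk; apply: eq_integrable.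
have /integrableP[_] := iB; apply: le_lt_trans.
rewrite integral_mkcond; apply: ge0_le_integral => //.
- by move=> x _; rewrite patchE; case: ifP => // _; rewrite lee_fin powR_ge0.
- have mh : measurable_fun X (fun x => (c x x0 `^ s)%:E).
    apply/measurable_EFinP; apply: (measurableT_comp (measurable_powR s)).
    apply: (@measurable_comp _ _ _ _ _ _ (X `*` X) (fun z => c z.1 z.2) X (fun x => (x, x0))) => //.
    + exact: measurableX.
    + by move=> _ [x Xx <-].
    + by apply: measurable_funTS; exact: measurable_fun_pair.
  exact: (measurable_restrictT _ mX).1 mh.
- by apply: measurableT_comp => //; exact: measurable_int iB.
move=> x _; rewrite patchE; case: ifPn => [|_]; last exact: abse_ge0.
rewrite inE => Xx /=; rewrite lee_fin; apply: le_trans (ler_norm _).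
rewrite -[leLHS]mulr1 -[X in _ * X <= _](pi1 x) mulr_sumr.
have -> : 2 `^ s * (\sum_i f i x * pi i x + k) =
    \sum_i (2 `^ s * (f i x + k) * pi i x).
  move: (k) => k'; rewrite mulrDr mulr_sumr -[2 `^ s * k']mulr1.
  rewrite -[X in _ + _ * X](pi1 x) [X in _ + X]mulr_sumr -big_split/=.
  by apply: eq_bigr => i _; ring.
apply: ler_sum => i _; rewrite ler_wpM2r//; first by have /andP[] := pi01 i x.
apply: le_trans (cost_to_triangle i Xx Xx0) _.
rewrite ler_wpM2l ?powR_ge0// lerD2l /k (bigD1 i)//= lerDl sumr_ge0// => j _.
exact: powR_ge0.
Qed.

Let mphi := measurable_gibbs_exponent Q mf lam u.

(** The dual optimal value: the logarithm of the density is
    - C - log_partition, and gibbs_mean evaluates the integral of C. *)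
Lemma KL_gibbs :
  KL G Q = (linear_part (r `^ s) lam u - log_partition Q f lam u)%:E.
Proof.
rewrite (KL_density QG); under eq_integral do rewrite expRK.
have [iC EC] := gibbs_mean mf f0 lam0 QG optimal.
have iN : G.-integrable setT (EFin \o (fun x => - pwmin (reduced_cost f lam u) x)).
  by have := integrableN iC; apply: eq_integrable.
have iL : G.-integrable setT (EFin \o (fun=> log_partition Q f lam u)).
  exact: finite_measure_integrable_cst.
have iphi : G.-integrable setT (EFin \o gibbs_exponent Q f lam u).
  by have := integrableB measurableT iN iL; apply: eq_integrable.
rewrite -[LHS]fineK; last exact: integrable_fin_num iphi.
congr (_%:E); transitivity (\int[G]_x gibbs_exponent Q f lam u x); first by [].
rewrite /gibbs_exponent RintegralB// Rintegral_cst_probability.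
congr (_ - _); rewrite -[RHS]opprK -EC -mulN1r -RintegralZl//.
by apply: eq_Rintegral => x _; rewrite mulN1r.
Qed.

(** P does at least as well as the feasible measure G, while weak duality bounds
    the integral of the Gibbs exponent under P from below by KL(G|Q). *)
Lemma least_favorable_gibbs P : least_favorable X c s r w Q P ->
  forall A, measurable A -> P A = G A.
Proof.
move=> [[[PX _] PW] Pmin].
pose m := \sum_i `|u i|.
have um i : `|u i| <= m by rewrite /m (bigD1 i)//= lerDl sumr_ge0.
have wd := weak_duality mX mc s_ge1 r_ge0 lam0 PX um PW.
set C := pwmin (reduced_cost f lam u).
have mC : measurable_fun setT C.
  by apply: measurable_pwmin => i; exact: measurable_reduced_cost.
have Cm x : 0 <= C x + m.
  rewrite -lerBlDr sub0r; apply: le_pwmin => i; rewrite /reduced_cost.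
  have := um i; have := ler_norm (u i); have : 0 <= lam * f i x by rewrite mulr_ge0.
  by move: (m) => m'; lra.
have iCm : P.-integrable setT (EFin \o (fun x => C x + m)).
  apply/integrableP; split; first by apply/measurable_EFinP; exact: measurable_funD.
  rewrite (eq_integral (fun x => (C x + m)%:E)); last first.
    by move=> x _ /=; rewrite ger0_norm.
  exact: le_lt_trans wd (ltry _).
have iz (z : R) : P.-integrable setT (EFin \o (fun=> z)).
  exact: finite_measure_integrable_cst.
have EC : \int[P]_x (C x + m) <= lam * r `^ s - n.+1%:R^-1 * \sum_i u i + m.
  by rewrite -lee_fin fineK//; exact: integrable_fin_num iCm.
have phiE x : gibbs_exponent Q f lam u x = (m - log_partition Q f lam u) - (C x + m).
  by rewrite /gibbs_exponent -/C; ring.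
have iphi : P.-integrable setT (EFin \o gibbs_exponent Q f lam u).
  have := integrableB measurableT (iz (m - log_partition Q f lam u)) iCm.
  by apply: eq_integrable => // x _ /=; rewrite phiE.
apply: (gibbs_unique mphi QG iphi (k := linear_part (r `^ s) lam u - log_partition Q f lam u)).
  by rewrite -KL_gibbs; apply: Pmin; exact: gibbs_feasible.
under eq_Rintegral do rewrite phiE.
rewrite RintegralB// Rintegral_cst_probability /linear_part.
move: EC; move: (\int[P]_x _) (_ * \sum_i u i) (log_partition _ _ _ _) => a b z; lra.
Qed.

End optimum.

End assembly.

Theorem theorem3p1 (R : realType) (d : nat) (X : set (euclid R d))
  (c : euclid R d -> euclid R d -> R) (Q : probability (euclid R d) R)
  (q : euclid R d -> R) (n : nat) (w : 'I_n.+1 -> euclid R d) (s r : R)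
  (mX : measurable X)
  (c_metric : metric_on X c)
  (mc : measurable_fun (X `*` X) (fun z => c z.1 z.2))
  (QX : concentrated_on X Q)
  (q_pdf : is_pdf X Q q)
  (wX : forall i, X (w i))
  (s_ge1 : 1 <= s) (r_ge0 : 0 <= r)
  (Pstar : probability (euclid R d) R)
  (Pstar_lf : least_favorable X c s r w Q Pstar)
  (lam : R) (u : 'I_n.+1 -> R)
  (lam_u_opt : dual_optimizer X c s r w q lam u) :
  (exists p, is_pdf X Pstar p) /\
  (forall p, is_pdf X Pstar p ->
     proportional_on X p (fun x => q x * expR (- Ccost c s w lam u x))).
Proof.
pose f := cost_to X c s w.
have mf i : measurable_fun setT (f i) by exact: measurable_cost_to.
have f0 i x : 0 <= f i x by exact: costX_ge0.
have lam0 : 0 <= lam by case: lam_u_opt.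
have [G QG] := probability_with_density
  (measurableT_comp (@measurable_expR R) (measurable_gibbs_exponent Q mf lam u))
  (fun x => expR_ge0 _) (gibbs_mass Q mf f0 u lam0).
have PG := least_favorable_gibbs mX c_metric mc QX q_pdf wX s_ge1 r_ge0
  lam_u_opt QG Pstar_lf.
have etaQ := etaE s mX mc q_pdf wX u lam0.
have CX x : X x -> Ccost c s w lam u x = pwmin (reduced_cost f lam u) x.
  exact: CcostE.
have eta0 : 0 < eta X c s w q lam u by rewrite etaQ; exact: partition_gt0.
pose k := (eta X c s w q lam u)^-1.
(* The density of G, with the normalizing constant k. *)
pose p0 x := k * (q x * expR (- Ccost c s w lam u x)).
have [mg g0 gE] := has_density_trans (has_density_restrict mX q_pdf) QG.
have p0E A : measurable A ->
    (\int[lebesgue d]_(x in A `&` X) (p0 x)%:E = Pstar A)%E.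
  move=> mA; rewrite PG// gE// integral_mkcondr; apply: eq_integral => x _.
  rewrite patchE /=; case: ifPn => [|_]; last by rewrite mulr0.
  rewrite inE => Xx; rewrite gibbs_densityE// -etaQ -CX//.
  by congr (_%:E); rewrite /p0 /k; ring.
have mp0 : measurable_fun X p0.
  have [mq _ _] := q_pdf.
  apply: measurable_funM => //; apply: measurable_funM => //.
  apply: (@eq_measurable_fun _ _ _ _ _ (fun x => expR (- pwmin (reduced_cost f lam u) x))).
    by move=> x; rewrite inE => Xx; rewrite CX.
  apply: measurable_funTS; apply: measurableT_comp => //; apply: measurable_funN.
  by apply: measurable_pwmin => i; exact: measurable_reduced_cost.
have p00 x : X x -> 0 <= p0 x.
  move=> Xx; have [_ q0 _] := q_pdf.
  by rewrite !mulr_ge0 ?expR_ge0 ?q0// invr_ge0 ltW.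
split; first by exists p0; split=> // A mA; rewrite p0E.
move=> p [mp p_ge0 pE].
exists k; first by rewrite invr_gt0.
have ip : (lebesgue d).-integrable X (EFin \o p).
  apply/integrableP; split; first exact/measurable_EFinP.
  rewrite (eq_integral (EFin \o p)); last first.
    by move=> x; rewrite inE => Xx /=; rewrite ger0_norm// p_ge0.
  rewrite -[X in integral _ X](setTI X) -pE//.
  exact: le_lt_trans (probability_le1 _ measurableT) (ltry 1).
have Ep E : E `<=` X -> measurable E ->
    (\int[lebesgue d]_(x in E) (p x)%:E = \int[lebesgue d]_(x in E) (p0 x)%:E)%E.
  by move=> EX mE; rewrite -(setIidl EX) -pE// p0E.
have mp0' : measurable_fun X (EFin \o p0) by exact/measurable_EFinP.
apply: filterS (integral_ae_eq mX ip mp0' Ep) => x /= h Xx.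
by have [] := h Xx.
Qed.
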